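(* Let $n,m\in\mathbb N$ and let $X,Y\in U_{m,n}(\mathbb C)$ be such that $\mathfrak m'=\mathrm{Span}_{\mathbb R}\{\hat X,\hat Y\}$ is a 2-dimensional subspace of $\mathfrak m\subset\mathfrak u(n,m)$. If $X^*Y=\mu I_n$ for some $\mu\in\mathbb R$, then $\mathfrak m'$ gives rise to a complete totally geodesic surface $S$ in $D_{n,m}$.
   Context: Let $\Lambda^n_m=\begin{pmatrix}-I_n&0\\ 0&I_m\end{pmatrix}$ and $U(n,m)=\{\Phi\in GL_{n+m}(\mathbb C):\Phi^*\Lambda^n_m\Phi=\Lambda^n_m\}$, with Lie algebra $\mathfrak u(n,m)$. $U(n)\times U(m)\subset U(n,m)$ is the block-diagonal subgroup, and $D_{n,m}=U(n,m)/(U(n)\times U(m))$ with origin $o$ (the identity coset), regarded as an affine symmetric space. Canonical decomposition: $\mathfrak u(n,m)=\mathfrak h+\mathfrak m$ with $\mathfrak h=\mathfrak u(n)+\mathfrak u(m)$ (block-diagonal) and $\mathfrak m=\{\hat X: X\in M_{m,n}(\mathbb C)\}$, where $\hat X=\begin{pmatrix}0&X^*\\ X&0\end{pmatrix}$; $\mathfrak m$ is identified with $T_oD_{n,m}$. $U_{m,n}(\mathbb C)=\{X\in M_{m,n}(\mathbb C): X^*X=\lambda I_n\text{ for some }\lambda\in\mathbb C\setminus\{0\}\}$ (then necessarily $\lambda>0$). A linear subspace $\mathfrak m'\subset\mathfrak m$ ''gives rise to'' a complete totally geodesic submanifold $S$ if there is a complete totally geodesic submanifold of $D_{n,m}$ through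 $o$ with tangent space $\mathfrak m'$ at $o$; $S$ is this submanifold or a translate of it by an element of $U(n,m)$. *)

(* Defs.v *)
From HB Require Import structures.
From mathcomp Require Import all_boot all_order all_algebra.
From mathcomp Require Import complex.
From mathcomp Require Import all_classical all_reals all_analysis.

Set Implicit Arguments.
Unset Strict Implicit.
Unset Printing Implicit Defensive.

Import Order.TTheory GRing.Theory Num.Theory.
Import numFieldNormedType.Exports.

Local Open Scope classical_set_scope.
Local Open Scope ring_scope.
Local Open Scope complex_scope.
Local Open Scope sesquilinear_scope.
Local Open Scope quotient_scope.

(* The norm topology of the complex numbers. *)
HB.instance Definition _ (R : realType) := NormedModule.copy R[i] (R[i]^o).

Section RealSpan.
Variables (R : realType) (p q : nat).

Definition rspan (s : seq 'M[R[i]]_(p, q)) : set 'M[R[i]]_(p, q) :=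
  [set M | exists c : 'I_(size s) -> R, M = \sum_i (c i)%:C *: s`_i].

Definition rfree (s : seq 'M[R[i]]_(p, q)) :=
  forall c : 'I_(size s) -> R,
    \sum_i (c i)%:C *: s`_i = 0 -> forall i, c i = 0.

(* [V] is a real linear subspace of dimension [k]. *)
Definition rdim (V : set 'M[R[i]]_(p, q)) (k : nat) :=
  exists s, [/\ size s = k, rfree s & V = rspan s].

End RealSpan.

Section Calculus.
Variable R : realType.

(* C^oo on the open set [U]: in finite dimension this is the existence and
   continuity of all iterated directional derivatives. *)
Definition smooth_on (V : normedModType R) (U : set V) (f : V -> R) :=
  forall (s : seq V) (x : V), U x ->
    let df := foldr (fun v g => fun y => 'D_v g y) f s in
    {for x, continuous df} /\ forall v, derivable df x v.

Definition smooth_mx (p q : nat) (V : normedModType R) (U : set V)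
    (F : V -> 'M[R[i]]_(p, q)) :=
  forall i j, smooth_on U (fun x => complex.Re (F x i j)) /\
              smooth_on U (fun x => complex.Im (F x i j)).

Definition is_derive_mx (p q : nat) (F : R -> 'M[R[i]]_(p, q)) (t : R)
    (dF : 'M[R[i]]_(p, q)) :=
  forall i j,
    is_derive t (1 : R) (fun x => complex.Re (F x i j)) (complex.Re (dF i j)) /\
    is_derive t (1 : R) (fun x => complex.Im (F x i j)) (complex.Im (dF i j)).

End Calculus.

Section PseudoUnitary.
Variables (R : realType) (n m : nat).
Local Notation M := 'M[R[i]]_(n + m).

Definition Lambda : M := block_mx (- 1%:M) 0 0 1%:M.

Definition Unm : set M :=
  [set P | P \in unitmx /\ P^t* *m Lambda *m P = Lambda].

Definition UnUm : set M :=
  [set P | exists (a : 'M[R[i]]_n) (d : 'M[R[i]]_m),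
     [/\ a \is unitarymx, d \is unitarymx & P = block_mx a 0 0 d]].

Definition hat (X : 'M[R[i]]_(m, n)) : M := block_mx 0 (X^t*) X 0.

Definition mspace : set M := range hat.

(* The projection of u(n,m) = h + m onto m. *)
Definition mpart (Z : M) : M := block_mx 0 (ursubmx Z) (dlsubmx Z) 0.

Definition Umn : set 'M[R[i]]_(m, n) :=
  [set X | exists2 l : R[i], l != 0 & X^t* *m X = l%:M].

Lemma adjM p q r (A : 'M[R[i]]_(p, q)) (B : 'M[R[i]]_(q, r)) :
  (A *m B)^t* = B^t* *m A^t*.
Proof. by rewrite trmx_mul map_mxM. Qed.

Lemma adj_block (a : 'M[R[i]]_n) (d : 'M[R[i]]_m) :
  (block_mx a 0 0 d)^t* = block_mx (a^t*) 0 0 (d^t*).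
Proof. by rewrite tr_block_mx map_block_mx !trmx0 !map_mx0. Qed.

Lemma Unm1 : Unm 1%:M.
Proof. by split; [exact: unitmx1 | rewrite trmx1 map_mx1 mul1mx mulmx1]. Qed.

Lemma UnmM P Q : Unm P -> Unm Q -> Unm (P *m Q).
Proof.
move=> [uP eP] [uQ eQ]; split; first by rewrite unitmx_mul uP.
by rewrite adjM !mulmxA -(mulmxA (Q^t*)) -(mulmxA (Q^t*)) eP.
Qed.

Lemma UnUm1 : UnUm 1%:M.
Proof.
by exists 1%:M, 1%:M; split; rewrite ?scalar_mx_block //;
  apply/unitarymxP; rewrite trmx1 map_mx1 mulmx1.
Qed.

Lemma UnUmM P Q : UnUm P -> UnUm Q -> UnUm (P *m Q).
Proof.
move=> [a [d [ua ud ->]]] [a' [d' [ua' ud' ->]]].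
exists (a *m a'), (d *m d'); split; try by rewrite mul_unitarymx.
by rewrite mulmx_block !mul0mx !mulmx0 !addr0 !add0r.
Qed.

Lemma UnUmV P : UnUm P -> UnUm (P^t*) /\ P *m P^t* = 1%:M.
Proof.
move=> [a [d [ua ud ->]]]; rewrite adj_block; split.
  by exists (a^t*), (d^t*); split; rewrite // trmxC_unitary.
rewrite mulmx_block !mul0mx !mulmx0 !addr0 !add0r.
by move/unitarymxP: ua => ->; move/unitarymxP: ud => ->; rewrite -scalar_mx_block.
Qed.

(* U(n,m) as a topological space, with the topology induced by the matrices. *)
Definition Gnm : Type := set_type Unm.
HB.instance Definition _ := Topological.on Gnm.

Definition gmx (g : Gnm) : M := set_val g.

Definition G1 : Gnm := SigSub (mem_set Unm1).

Definition gmul (g h : Gnm) : Gnm :=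
  SigSub (mem_set (UnmM (set_valP g) (set_valP h))).

Definition same_coset : rel Gnm :=
  fun g h => `[< exists2 k, UnUm k & gmx h = gmx g *m k >].

Lemma same_coset_equiv : equiv_class_of same_coset.
Proof.
have refl : reflexive same_coset.
  by move=> g; apply/asboolP; exists 1%:M; [exact: UnUm1 | rewrite mulmx1].
have sym g h : same_coset g h -> same_coset h g.
  move=> /asboolP[k /UnUmV[kV kK] e]; apply/asboolP; exists (k^t*) => //.
  by rewrite e -mulmxA kK mulmx1.
split=> //; first by move=> g h; apply/idP/idP; exact: sym.
move=> h g f /asboolP[k Kk e] /asboolP[k' Kk' e']; apply/asboolP.
by exists (k *m k'); [exact: UnUmM | rewrite e' e mulmxA].
Qed.

Canonical same_coset_equiv_rel := EquivRelPack same_coset_equiv.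

(* The coset space U(n,m) / (U(n) x U(m)). *)
Definition Dnm : Type := quotient_topology {eq_quot same_coset}.
HB.instance Definition _ := Topological.on Dnm.

Definition coset (g : Gnm) : Dnm := \pi_{eq_quot same_coset} g.

Definition origin : Dnm := coset G1.

Definition translate (g : Gnm) (S : set Dnm) : set Dnm :=
  [set p | exists2 h, S (coset h) & p = coset (gmul g h)].

(* U(n,m) -> D is a principal bundle: a map into D is smooth iff it lifts
   locally to a smooth matrix-valued map with values in U(n,m). *)
Definition smooth_map (V : normedModType R) (U : set V) (f : V -> Dnm) :=
  forall x, U x -> exists (U' : set V) (F : V -> Gnm),
    [/\ open U', U' x, smooth_mx U' (fun y => gmx (F y)) &
        forall y, U' y -> f y = coset (F y)].

(* The tangent space at [coset g] is g_* m: the frame [g] identifies it with m,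
   and a frame g k, with k in U(n) x U(m), changes B in m into k^-1 B k.
   [velocity c t g B] says that [c t = coset g] and [c'(t) = g_* B]; for a lift
   F of c through g, this B is the m-component of g^-1 F'(t). *)
Definition velocity (c : R -> Dnm) (t : R) (g : Gnm) (B : M) :=
  exists (F : R -> Gnm) (dF : M),
    [/\ \forall s \near t, c s = coset (F s), F t = g,
        is_derive_mx (fun s => gmx (F s)) t dF &
        B = mpart (invmx (gmx g) *m dF)].

(* Geodesics, on the open set [J], of the canonical connection of the affine
   symmetric space D.  Its horizontal distribution on U(n,m) -> D is spanned by
   the left translates of m, so that if F is a horizontal lift of the curve c
   (F' = F A with A in m), then c' = F_* A and the covariant derivative of c'
   along c is F_* A'.  A geodesic is a curve whose covariant acceleration
   vanishes. *)
Definition geodesic (J : set R) (c : R -> Dnm) :=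
  exists (F : R -> Gnm) (A : R -> M), forall t, J t ->
    [/\ c t = coset (F t), mspace (A t),
        is_derive_mx (fun s => gmx (F s)) t (gmx (F t) *m A t) &
        is_derive_mx A t 0].

(* Embedded submanifolds of dimension k, by local parametrizations that are
   injective immersions and homeomorphisms onto relatively open subsets. *)
Definition submanifold (k : nat) (S : set Dnm) :=
  forall p, S p ->
  exists (W : set Dnm) (U : set 'rV[R]_k) (phi : 'rV[R]_k -> Dnm),
    [/\ open W /\ W p,
        open U /\ smooth_map U phi,
        phi @` U = S `&` W /\ {in U &, injective phi},
        forall u v g, U u -> v <> 0 ->
          ~ velocity (fun t : R => phi (u + t *: v)) 0 g 0 &
        forall U', open U' -> U' `<=` U ->
          exists2 W', open W' & phi @` U' = S `&` W'].

(* The tangent space of S at [coset g], read in the frame g. *)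
Definition tangent (S : set Dnm) (g : Gnm) : set M :=
  [set B | exists (e : R) (c : R -> Dnm),
     [/\ 0 < e, smooth_map `]-e, e[ c, forall t : R, - e < t < e -> S (c t) &
         velocity c 0 g B]].

Definition totally_geodesic (S : set Dnm) :=
  forall g B (e : R) c, S (coset g) -> tangent S g B ->
    0 < e -> geodesic `]-e, e[ c -> velocity c 0 g B ->
    \forall t \near 0, S (c t).

(* For a totally geodesic submanifold, whose geodesics are the geodesics of D
   lying in it: every geodesic is defined on the whole real line. *)
Definition geodesically_complete (S : set Dnm) :=
  forall g B, S (coset g) -> tangent S g B ->
    exists c : R -> Dnm,
      [/\ geodesic setT c, velocity c 0 g B & forall t, S (c t)].

Definition complete_tg_submanifold (k : nat) (S : set Dnm) :=
  [/\ submanifold k S, connected S, totally_geodesic S &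
      geodesically_complete S].

(* T_o D is identified with m through the frame given by the identity. *)
Definition gives_rise_to (k : nat) (V : set M) (S : set Dnm) :=
  exists (S0 : set Dnm) (g : Gnm),
    [/\ complete_tg_submanifold k S0, S0 origin, tangent S0 G1 = V &
        S = translate g S0].

End PseudoUnitary.

(* Main.v *)
Require Import Defs.
From mathcomp Require Import all_boot all_order all_algebra.
From mathcomp Require Import complex ring lra.
From mathcomp Require Import all_classical all_reals all_analysis.

Set Implicit Arguments.
Unset Strict Implicit.
Unset Printing Implicit Defensive.

Import Order.TTheory GRing.Theory Num.Theory.
Import numFieldNormedType.Exports.

Local Open Scope classical_set_scope.
Local Open Scope ring_scope.
Local Open Scope complex_scope.
Local Open Scope sesquilinear_scope.

(** After orthonormalization, m' is spanned over the reals by the hats of two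
    matrices P_1, P_2 with P_i^* P_j = delta_ij.  Together with the inclusion E_0 of
    C^n as the first n coordinates, the columns E_i = (0, P_i) form an orthonormal
    frame E_0, E_1, E_2 : C^n -> C^(n+m).  A real 3 x 3 matrix A acts on the copy of
    C^n (x) R^3 so embedded and as the identity on its orthogonal complement.  This gives
    a homomorphism rho ([frame_repM]) that commutes with adjoints and sends eta =
    diag(-1,1,1) to Lambda ([frame_rep_eta]).  Hence rho maps the Lorentz group
    O(1,2) into U(n,m), and its linear counterpart [frame_mx] maps the infinitesimal
    boosts onto m' ([tangent_lorentz_orbit2]).  The surface S is the orbit of the
    origin under rho(O(1,2)): a copy of the hyperbolic plane.

    All statements about the coset space are read through the Cartan embedding gK
    |-> g g^*, which is well defined and injective on cosets ([coset_eqP]).  It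
    turns the velocity B at g into the derivative 2 g B g^* ([velocity_cartan]).  On
    S the values of the embedding lie in the image of a real affine map, so
    differentiating shows that a vector tangent to S at rho(A) K becomes an
    infinitesimal boost in the frame rho(A) ([tangent_adapted]).  Infinitesimal
    boosts T with T^3 = T have the explicit exponential 1 + sinh t T + (cosh t - 1)
    T^2, and all others are multiples of these.  So the curves rho(A exp(t r T)) K
    are geodesics defined for all times that stay in S ([lorentz_orbit_complete]);
    uniqueness for F' = F D with D constant identifies every geodesic tangent to S
    with one of them ([lorentz_orbit_totally_geodesic]).  These arguments hold for
    any number of orthonormal matrices P_i.

    That S is an embedded surface is seen in horospherical coordinates (s, x), that
    is, on the factor NA of an Iwasawa decomposition of O(1,2).  The entries of the
    lift are polynomials in x and exp(s), exp(-s), hence smooth, and the coordinates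
    are recovered from two real linear functions of the Cartan embedding, which are
    continuous on the whole coset space ([chartK], [chart_open]). *)

(** * Elementary functions *)

Section Elementary.
Context {R : realType} {V : normedModType R}.

(** A class closed under directional derivatives, so that membership alone gives
    the existence and continuity of all iterated derivatives. *)
Inductive elementary : (V -> R) -> Prop :=
| elementary_cst (a : R) : elementary (fun=> a)
| elementary_lin (l : V -> R) : scalar l -> continuous l -> elementary l
| elementary_exp f : elementary f -> elementary (fun x => expR (f x))
| elementaryD f g : elementary f -> elementary g ->
    elementary (fun x => f x + g x)
| elementaryM f g : elementary f -> elementary g ->
    elementary (fun x => f x * g x).

Lemma elementary_continuous f : elementary f -> continuous f.
Proof.
elim=> {f} [a|l _ cl|f _ cf|f g _ cf _ cg|f g _ cf _ cg] x.
- exact: cvg_cst.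
- exact: cl.
- by apply: (@continuous_comp _ _ _ f expR); [exact: cf|exact: continuous_expR].
- exact: continuousD (cf x) (cg x).
- exact: continuousM (cf x) (cg x).
Qed.

(** Reduces directional derivatives to one real variable, where the chain rule for
    the exponential lives. *)
Lemma is_derive_line (W : normedModType R) (f : V -> W) (x v : V) (df : W) :
  is_derive x v f df <-> is_derive (0 : R) 1 (fun h : R => f (h *: v + x)) df.
Proof.
have e : 'D_v f x = 'D_1 (fun h : R => f (h *: v + x)) 0.
  rewrite /derive; set g1 := fun h => h^-1 *: _; set g2 := fun h => h^-1 *: _.
  suff -> : g1 = g2 by [].
  by apply/funext => h; rewrite /g1 /g2 /= addr0 scale0r add0r [_%:A]mulr1.
split=> -[d1 <-]; apply: DeriveDef; rewrite ?e //.
  exact: (derivable1P f x v).1 d1.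
exact: (derivable1P f x v).2 d1.
Qed.

Lemma is_derive_exp_comp (f : V -> R) x v (df : R) :
  is_derive x v f df -> is_derive x v (fun y => expR (f y)) (expR (f x) * df).
Proof.
move=> /is_derive_line fx; apply/is_derive_line.
have := @is_derive1_comp R expR (fun h : R => f (h *: v + x)) 0 (expR (f x)) df.
apply=> //; rewrite scale0r add0r; exact: is_derive_expR.
Qed.

Lemma elementary_derive f v : elementary f ->
  exists2 df, elementary df & forall x, is_derive x v f (df x).
Proof.
elim=> {f} [a|l ll cl|f ef [df edf dfE]|f g ef [df edf dfE] eg [dg edg dgE]
           |f g ef [df edf dfE] eg [dg edg dgE]].
- by exists (fun=> 0) => [|x]; [exact: elementary_cst|exact: is_derive_cst].
- exists (fun=> l v) => [|x]; first exact: elementary_cst.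
  apply/is_derive_line.
  have := is_deriveD (is_deriveZ (l v) (is_derive_id (0 : R) (1 : R)))
    (is_derive_cst (l x : R) (0 : R) (1 : R)).
  rewrite addr0 [_ *: _]mulr1; congr is_derive.
  by apply/funext => h; rewrite ll [_ * l v]mulrC.
- exists (fun x => expR (f x) * df x); last by move=> x; exact: is_derive_exp_comp.
  by apply: elementaryM => //; exact: elementary_exp.
- exists (fun x => df x + dg x); first exact: elementaryD.
  by move=> x; exact: is_deriveD.
- exists (fun x => f x * dg x + g x * df x).
    by apply: elementaryD; exact: elementaryM.
  by move=> x; exact: is_deriveM.
Qed.

Lemma elementary_smooth (U : set V) f : elementary f -> smooth_on U f.
Proof.
move=> ef s x _ df.
suff edf : elementary df.
  split=> [|v]; first exact: elementary_continuous.
  by have [g _ /(_ x)[]] := elementary_derive v edf.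
rewrite /df {df}; elim: s => //= v s /(elementary_derive v)[dg edg dgE].
suff -> : 'D_v (foldr (fun v g => 'D_v g) f s) = dg by [].
by apply/funext => y; have [_ ->] := dgE y.
Qed.

Lemma elementaryN f : elementary f -> elementary (fun x => - f x).
Proof.
move=> ef; rewrite (_ : (fun _ => _) = (fun x => -1 * f x)).
  by apply: elementaryM => //; exact: elementary_cst.
by apply/funext => x; rewrite mulN1r.
Qed.

Lemma elementary_sum I (r : seq I) (F : I -> V -> R) :
  (forall i, elementary (F i)) -> elementary (fun x => \sum_(i <- r) F i x).
Proof.
move=> eF; elim: r => [|i r IH].
  rewrite (_ : (fun _ => _) = fun=> 0); first exact: elementary_cst.
  by apply/funext => x; rewrite big_nil.
rewrite (_ : (fun _ => _) = fun x => F i x + \sum_(j <- r) F j x).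
  exact: elementaryD.
by apply/funext => x; rewrite big_cons.
Qed.

End Elementary.

(** * Derivatives of complex matrix curves *)

Section ReIm.
Context {R : realType}.
Implicit Types (a : R) (x y : R[i]).

Lemma ReD x y : complex.Re (x + y) = complex.Re x + complex.Re y.
Proof. by case: x y => ? ? []. Qed.

Lemma ImD x y : complex.Im (x + y) = complex.Im x + complex.Im y.
Proof. by case: x y => ? ? []. Qed.

Lemma ReM x y : complex.Re (x * y) =
  complex.Re x * complex.Re y - complex.Im x * complex.Im y.
Proof. by case: x y => ? ? []. Qed.

Lemma ImM x y : complex.Im (x * y) =
  complex.Re x * complex.Im y + complex.Im x * complex.Re y.
Proof. by case: x y => ? ? []. Qed.

Lemma ReJ x : complex.Re (x^*)%R = complex.Re x. Proof. by case: x. Qed.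

Lemma ImJ x : complex.Im (x^*)%R = - complex.Im x. Proof. by case: x. Qed.

Lemma ReZ a x : complex.Re (a%:C * x) = complex.Re x * a.
Proof. by case: x => ? ? /=; ring. Qed.

Lemma ImZ a x : complex.Im (a%:C * x) = complex.Im x * a.
Proof. by case: x => ? ? /=; ring. Qed.

Lemma Re_sum I (r : seq I) (f : I -> R[i]) :
  complex.Re (\sum_(k <- r) f k) = \sum_(k <- r) complex.Re (f k).
Proof. exact: (big_morph _ ReD). Qed.

Lemma Im_sum I (r : seq I) (f : I -> R[i]) :
  complex.Im (\sum_(k <- r) f k) = \sum_(k <- r) complex.Im (f k).
Proof. exact: (big_morph _ ImD). Qed.

End ReIm.

Section DeriveMatrix.
Context {R : realType}.
Local Notation C := R[i].

Lemma near_eq_is_derive_mx p q (F G : R -> 'M[C]_(p, q)) t D :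
  (\forall s \near t, F s = G s) -> is_derive_mx F t D -> is_derive_mx G t D.
Proof.
move=> FG dF i j; have [rF iF] := dF i j.
by split; [apply: near_eq_is_derive rF|apply: near_eq_is_derive iF];
  apply: filterS FG => s ->.
Qed.

Lemma is_derive_mx_unique p q (F : R -> 'M[C]_(p, q)) t D D' :
  is_derive_mx F t D -> is_derive_mx F t D' -> D = D'.
Proof.
move=> dF dF'; apply/matrixP => i j.
have [rF iF] := dF i j; have [rF' iF'] := dF' i j.
apply/eqP; rewrite eq_complex -(@derive_val _ _ _ _ _ _ _ rF) -(@derive_val _ _ _ _ _ _ _ iF).
by rewrite (@derive_val _ _ _ _ _ _ _ rF') (@derive_val _ _ _ _ _ _ _ iF') !eqxx.
Qed.

Lemma is_derive_mx_cst p q (A : 'M[C]_(p, q)) (t : R) :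
  is_derive_mx (fun=> A) t 0.
Proof. by move=> i j; rewrite !mxE; split; exact: is_derive_cst. Qed.

Lemma is_derive_mxD p q (F G : R -> 'M[C]_(p, q)) t D D' :
  is_derive_mx F t D -> is_derive_mx G t D' ->
  is_derive_mx (fun s => F s + G s) t (D + D').
Proof.
move=> dF dG i j; have [rF iF] := dF i j; have [rG iG] := dG i j.
rewrite mxE ReD ImD; split.
- rewrite (_ : (fun _ => _) = (fun s => complex.Re (F s i j)) +
    (fun s => complex.Re (G s i j))); first exact: is_deriveD.
  by apply/funext => s; rewrite mxE ReD.
- rewrite (_ : (fun _ => _) = (fun s => complex.Im (F s i j)) +
    (fun s => complex.Im (G s i j))); first exact: is_deriveD.
  by apply/funext => s; rewrite mxE ImD.
Qed.

Lemma is_derive_mxM p q r (F : R -> 'M[C]_(p, q)) (G : R -> 'M[C]_(q, r)) t D D' :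
  is_derive_mx F t D -> is_derive_mx G t D' ->
  is_derive_mx (fun s => F s *m G s) t (D *m G t + F t *m D').
Proof.
move=> dF dG i j.
pose re (s : R) k := complex.Re (F s i k) * complex.Re (G s k j) -
  complex.Im (F s i k) * complex.Im (G s k j).
pose im (s : R) k := complex.Re (F s i k) * complex.Im (G s k j) +
  complex.Im (F s i k) * complex.Re (G s k j).
pose dre k := complex.Re (D i k * G t k j + F t i k * D' k j).
pose dim k := complex.Im (D i k * G t k j + F t i k * D' k j).
have dreE k : is_derive t (1 : R) (fun s => re s k) (dre k).
  have [rF iF] := dF i k; have [rG iG] := dG k j.
  apply: is_derive_eq (is_deriveB (is_deriveM rF rG) (is_deriveM iF iG)) _.
  by rewrite /dre ReD !ReM /GRing.scale /=; ring.
have dimE k : is_derive t (1 : R) (fun s => im s k) (dim k).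
  have [rF iF] := dF i k; have [rG iG] := dG k j.
  apply: is_derive_eq (is_deriveD (is_deriveM rF iG) (is_deriveM iF rG)) _.
  by rewrite /dim ImD !ImM /GRing.scale /=; ring.
rewrite !mxE -big_split /= Re_sum Im_sum; split.
- rewrite (_ : (fun _ => _) = \sum_(k < q) re^~ k).
    exact: (is_derive_sum dreE).
  apply/funext => s; rewrite mxE Re_sum fct_sumE; apply: eq_bigr => k _.
  by rewrite ReM.
- rewrite (_ : (fun _ => _) = \sum_(k < q) im^~ k).
    exact: (is_derive_sum dimE).
  apply/funext => s; rewrite mxE Im_sum fct_sumE; apply: eq_bigr => k _.
  by rewrite ImM.
Qed.

Lemma is_derive_mxMl p q r (A : 'M[C]_(p, q)) (F : R -> 'M[C]_(q, r)) t D :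
  is_derive_mx F t D -> is_derive_mx (fun s => A *m F s) t (A *m D).
Proof.
move=> /(is_derive_mxM (is_derive_mx_cst A t)); rewrite mul0mx add0r; exact.
Qed.

Lemma is_derive_mxMr p q r (F : R -> 'M[C]_(p, q)) (A : 'M[C]_(q, r)) t D :
  is_derive_mx F t D -> is_derive_mx (fun s => F s *m A) t (D *m A).
Proof.
move=> /is_derive_mxM/(_ (is_derive_mx_cst A t)); rewrite mulmx0 addr0; exact.
Qed.

Lemma is_derive_mx_adj p q (F : R -> 'M[C]_(p, q)) t D :
  is_derive_mx F t D -> is_derive_mx (fun s => (F s)^t*) t (D^t*).
Proof.
move=> dF i j; have [rF iF] := dF j i; rewrite !mxE ReJ ImJ; split.
- rewrite (_ : (fun _ => _) = (fun s => complex.Re (F s j i))) //.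
  by apply/funext => s; rewrite !mxE ReJ.
- rewrite (_ : (fun _ => _) = - (fun s => complex.Im (F s j i))).
    exact: is_deriveN.
  by apply/funext => s; rewrite !mxE ImJ.
Qed.

Lemma is_derive_mxZ p q (f : R -> R) (A : 'M[C]_(p, q)) t (df : R) :
  is_derive t (1 : R) f df ->
  is_derive_mx (fun s => (f s)%:C *: A) t (df%:C *: A).
Proof.
move=> df_ i j; rewrite mxE ReZ ImZ; split.
- rewrite (_ : (fun _ => _) = complex.Re (A i j) \*: f); first exact: is_deriveZ.
  by apply/funext => s; rewrite mxE ReZ.
- rewrite (_ : (fun _ => _) = complex.Im (A i j) \*: f); first exact: is_deriveZ.
  by apply/funext => s; rewrite mxE ImZ.
Qed.

Lemma is_derive_mx_sum p q I (r : seq I) (F : I -> R -> 'M[C]_(p, q)) t D :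
  (forall i, is_derive_mx (F i) t (D i)) ->
  is_derive_mx (fun s => \sum_(i <- r) F i s) t (\sum_(i <- r) D i).
Proof.
move=> dF; elim: r => [|i r IH].
  rewrite big_nil (_ : (fun _ => _) = fun=> 0); first exact: is_derive_mx_cst.
  by apply/funext => s; rewrite big_nil.
rewrite big_cons (_ : (fun _ => _) = fun s => F i s + \sum_(j <- r) F j s).
  exact: is_derive_mxD.
by apply/funext => s; rewrite big_cons.
Qed.

Lemma derive0_constant (f : R -> R) (e : R) :
  (forall s, - e < s < e -> is_derive s (1 : R) f 0) ->
  forall t, - e < t < e -> f t = f 0.
Proof.
move=> df.
have main a b : - e < a -> b < e -> a <= b -> f a = f b.
  move=> ea be ab.
  have dab x : x \in `[a, b] -> is_derive x 1 f 0.
    rewrite in_itv /= => /andP[ax xb]; apply: df.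
    by rewrite (lt_le_trans ea ax) (le_lt_trans xb be).
  have cf : {within `[a, b], continuous f}.
    apply: derivable_within_continuous => x xab.
    by have [] := dab x xab.
  have dab' x : x \in `]a, b[ -> is_derive x 1 f (cst 0 x).
    by move=> xab; apply: dab; exact: subset_itv_oo_cc xab.
  have [c _] := MVT_segment ab dab' cf.
  by rewrite mul0r => /eqP; rewrite subr_eq0 => /eqP.
move=> t /andP[et te]; case: (leP t 0) => [t0|/ltW t0].
  by apply: main => //; lra.
by apply/esym/main => //; lra.
Qed.

(** The uniqueness half of the linear differential equations met below: two
    solutions are compared through a product whose derivative vanishes. *)
Lemma derive0_mx_constant p q (F : R -> 'M[C]_(p, q)) (e : R) :
  (forall s, - e < s < e -> is_derive_mx F s 0) ->
  forall t, - e < t < e -> F t = F 0.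
Proof.
move=> dF t te; apply/matrixP => i j; apply/eqP; rewrite eq_complex.
apply/andP; split; apply/eqP.
- apply: (@derive0_constant (fun s => complex.Re (F s i j)) e) => // s /dF.
  by move=> /(_ i j)[]; rewrite mxE.
- apply: (@derive0_constant (fun s => complex.Im (F s i j)) e) => // s /dF.
  by move=> /(_ i j)[]; rewrite mxE.
Qed.

End DeriveMatrix.

(** * Real matrices acting through an orthonormal frame *)

Section Frame.
Context {R : realType} {N n k : nat}.
Local Notation C := R[i].
Variable E : 'I_k -> 'M[C]_(N, n).
Hypothesis orthoE : forall i j, (E i)^t* *m E j = (i == j)%:R%:M.

(** In block form this is E (T (x) 1) E^* with E = (E_1 ... E_k): the endomorphism T
    of R^k transported to the span of the frame. *)
Definition frame_mx (T : 'M[R]_k) : 'M[C]_N :=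
  \sum_i \sum_j (T i j)%:C *: (E i *m (E j)^t*).

Lemma frame_mxD S T : frame_mx (S + T) = frame_mx S + frame_mx T.
Proof.
rewrite /frame_mx -big_split; apply: eq_bigr => i _ /=.
rewrite -big_split; apply: eq_bigr => j _ /=.
by rewrite mxE raddfD scalerDl.
Qed.

Lemma frame_mxZ a T : frame_mx (a *: T) = a%:C *: frame_mx T.
Proof.
rewrite /frame_mx scaler_sumr; apply: eq_bigr => i _ /=.
rewrite scaler_sumr; apply: eq_bigr => j _ /=.
by rewrite mxE rmorphM scalerA.
Qed.

Lemma frame_mxN T : frame_mx (- T) = - frame_mx T.
Proof. by rewrite -scaleN1r frame_mxZ rmorphN1 scaleN1r. Qed.

Lemma frame_mx_adj T : (frame_mx T)^t* = frame_mx T^T.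
Proof.
rewrite /frame_mx exchange_big /= raddf_sum raddf_sum /=; apply: eq_bigr => i _.
rewrite raddf_sum raddf_sum /=; apply: eq_bigr => j _.
rewrite mxE linearZ map_mxZ adjM trmxCK; congr (_ *: _).
exact: conjc_real.
Qed.

Lemma frame_mx_row i T : (E i)^t* *m frame_mx T = \sum_j (T i j)%:C *: (E j)^t*.
Proof.
rewrite /frame_mx mulmx_sumr (bigD1 i) //= [X in _ + X]big1 ?addr0; last first.
  move=> l li; rewrite mulmx_sumr big1 // => j _.
  by rewrite -scalemxAr mulmxA orthoE eq_sym (negPf li) raddf0 mul0mx scaler0.
rewrite mulmx_sumr; apply: eq_bigr => j _.
by rewrite -scalemxAr mulmxA orthoE eqxx mul1mx.
Qed.

Lemma frame_mxM S T : frame_mx S *m frame_mx T = frame_mx (S *m T).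
Proof.
rewrite [frame_mx S]/frame_mx mulmx_suml; apply: eq_bigr => i _.
rewrite mulmx_suml.
under eq_bigr => j _ do rewrite -scalemxAl -mulmxA frame_mx_row mulmx_sumr scaler_sumr.
rewrite exchange_big /=; apply: eq_bigr => l _.
rewrite mxE rmorph_sum scaler_suml; apply: eq_bigr => j _.
by rewrite -scalemxAr scalerA rmorphM.
Qed.

(** For M = frame_mx T, each product E_i^* M E_j is the scalar matrix T_ij, so any
    diagonal entry o recovers T. *)
Definition coef (o : 'I_n) (M : 'M[C]_N) : 'M[R]_k :=
  \matrix_(i, j) complex.Re (((E i)^t* *m M *m E j) o o).

Lemma coef_frame_mx o T : coef o (frame_mx T) = T.
Proof.
apply/matrixP => i j; rewrite mxE frame_mx_row mulmx_suml summxE (bigD1 j) //=.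
rewrite big1 ?addr0 => [|l lj]; last first.
  by rewrite -scalemxAl orthoE (negPf lj) raddf0 scaler0 mxE.
by rewrite -scalemxAl orthoE eqxx !mxE eqxx mulr1.
Qed.

(** A (x) 1 on the span of the frame, and the identity on its orthogonal complement;
    the subtraction of 1 makes this multiplicative without naming a projector. *)
Definition frame_rep (A : 'M[R]_k) : 'M[C]_N := 1%:M + frame_mx (A - 1%:M).

Lemma coef_frame_rep o A : coef o (frame_rep A) = A.
Proof.
have coefD (S T : 'M[C]_N) : coef o (S + T) = coef o S + coef o T.
  have cE U i j : coef o U i j = complex.Re (((E i)^t* *m U *m E j) o o).
    by rewrite mxE.
  apply/matrixP => i j; rewrite cE [RHS]mxE !cE.
  by rewrite mulmxDr mulmxDl mxE; case: (_ o o) (_ o o) => ? ? [].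
have coef1 : coef o 1%:M = 1%:M.
  apply/matrixP => i j; rewrite mxE mulmx1 orthoE !mxE eqxx mulr1n.
  by case: (i == j).
by rewrite /frame_rep coefD coef_frame_mx coef1 addrC subrK.
Qed.

Lemma frame_rep1 : frame_rep 1%:M = 1%:M.
Proof. by rewrite /frame_rep subrr -(scale0r 0) frame_mxZ scale0r addr0. Qed.

Lemma frame_repM A B : frame_rep A *m frame_rep B = frame_rep (A *m B).
Proof.
rewrite /frame_rep mulmxDl mul1mx mulmxDr mulmx1 frame_mxM -!addrA; congr (_ + _).
rewrite -!frame_mxD; congr (frame_mx _).
rewrite mulmxBl mulmxBr !mulmx1 mul1mx.
by rewrite [X in _ + X]addrA [LHS]addrC subrK addrC addrA subrK.
Qed.

Lemma frame_rep_mx A T : frame_rep A *m frame_mx T = frame_mx (A *m T).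
Proof.
rewrite /frame_rep mulmxDl mul1mx frame_mxM -frame_mxD mulmxBl mul1mx.
by rewrite addrCA subrr addr0.
Qed.

Lemma frame_mx_rep A T : frame_mx T *m frame_rep A = frame_mx (T *m A).
Proof.
rewrite /frame_rep mulmxDr mulmx1 frame_mxM -frame_mxD mulmxBr mulmx1.
by rewrite addrCA subrr addr0.
Qed.

Lemma frame_rep_adj A : (frame_rep A)^t* = frame_rep A^T.
Proof.
rewrite /frame_rep linearD /= map_mxD frame_mx_adj trmx1 map_mx1 linearB /=.
by rewrite trmx1.
Qed.

Lemma frame_mx_inj : (0 < n)%N -> injective frame_mx.
Proof.
move=> n0 A B /(congr1 (coef (Ordinal n0))).
by rewrite !coef_frame_mx.
Qed.

End Frame.

(** * The Lorentz group *)

Section Lorentz.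
Context {R : realType} {p : nat}.
Implicit Types (A B T : 'M[R]_p.+1).

Definition eta : 'M[R]_p.+1 := diag_mx (\row_i (-1) ^+ (i == ord0)).

Lemma eta_sqr : eta *m eta = 1%:M.
Proof.
rewrite /eta mulmx_diag -diag_const_mx; congr diag_mx; apply/rowP => i.
by rewrite !mxE -expr2 sqrr_sign.
Qed.

Lemma eta_conjE T i j :
  (eta *m T *m eta) i j = (-1) ^+ (i == ord0) * T i j * (-1) ^+ (j == ord0).
Proof. by rewrite /eta mul_diag_mx mul_mx_diag !mxE. Qed.

Definition lorentz A := A^T *m eta *m A = eta.

Lemma lorentz_inv A : lorentz A -> (eta *m A^T *m eta) *m A = 1%:M.
Proof. by move=> lA; rewrite -!mulmxA [A^T *m _]mulmxA lA eta_sqr. Qed.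

(** The left inverse eta A^T eta of A is also a right inverse. *)
Lemma lorentz_tr A : lorentz A -> A *m eta *m A^T = eta.
Proof.
move=> /lorentz_inv /mulmx1C e; rewrite !mulmxA in e.
by rewrite -[LHS]mulmx1 -eta_sqr !mulmxA e mul1mx.
Qed.

Lemma lorentzM A B : lorentz A -> lorentz B -> lorentz (A *m B).
Proof.
rewrite /lorentz => lA lB; rewrite trmx_mul !mulmxA -(mulmxA (B^T)) -(mulmxA (B^T)).
by rewrite lA.
Qed.

Lemma lorentz1 : lorentz 1%:M.
Proof. by rewrite /lorentz trmx1 mul1mx mulmx1. Qed.

(** The symmetric part of the Lie algebra so(1,p): anticommuting with eta forces the
    even blocks to vanish, which leaves the first row and column. *)
Definition boost_gen T := T^T = T /\ eta *m T *m eta = - T.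

Lemma boost_gen_even T i j : boost_gen T -> (i == ord0) = (j == ord0) -> T i j = 0.
Proof.
move=> [_ /matrixP/(_ i j)]; rewrite eta_conjE mxE => + ij.
rewrite ij mulrAC -expr2 sqrr_sign mul1r => /eqP.
by rewrite -addr_eq0 -mulr2n -mulr_natl mulf_eq0 pnatr_eq0 => /eqP.
Qed.

Lemma boost_genZ a T : boost_gen T -> boost_gen (a *: T).
Proof.
move=> [sT eT]; split; first by rewrite linearZ /= sT.
by rewrite -scalemxAr -scalemxAl eT scalerN.
Qed.

(** T = e w^T + w e^T with e the first basis vector and w its image, orthogonal to
    e; hence T^3 = |w|^2 T. *)
Lemma boost_gen_cube T : boost_gen T ->
  T *m T *m T = (\sum_i T i ord0 ^+ 2) *: T.
Proof.
move=> bT; have [sT _] := bT; set a := \sum_i _.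
pose e : 'cV[R]_p.+1 := delta_mx ord0 ord0.
pose w := col ord0 T.
have TE : T = e *m w^T + w *m e^T.
  apply/matrixP => i j; rewrite !mxE !big_ord1 !mxE eqxx andbT.
  have sE k l : T k l = T l k by rewrite -{1}sT mxE.
  case: (eqVneq i ord0) (eqVneq j ord0) => [->|i0] [->|j0].
  - by rewrite (boost_gen_even bT)// !(mulr0, mul0r, addr0).
  - by rewrite !(mulr0, mul1r, addr0) sE.
  - by rewrite !(mul0r, mulr1, add0r).
  - by rewrite !(mulr0, mul0r, addr0) (boost_gen_even bT)// (negPf i0) (negPf j0).
have ee : e^T *m e = 1%:M by rewrite trmx_delta mul_delta_mx; apply/rowP => i; rewrite !mxE !ord1.
have we : w^T *m e = 0.
  rewrite /e -colE; apply/matrixP => i j.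
  by rewrite !mxE (boost_gen_even bT).
have ew : e^T *m w = 0 by rewrite -[w]trmxK -trmx_mul we trmx0.
have ww : w^T *m w = a%:M.
  apply/matrixP => i j; rewrite !ord1 !mxE mulr1n; apply: eq_bigr => k _.
  by rewrite !mxE expr2.
have TT : T *m T = a *: (e *m e^T) + w *m w^T.
  rewrite TE mulmxDl !mulmxDr -!mulmxA (mulmxA (w^T)) we mul0mx mulmx0 add0r.
  rewrite (mulmxA (w^T)) ww (mulmxA (e^T)) ee (mulmxA (e^T)) ew mul0mx mulmx0 addr0.
  by rewrite mul1mx mul_scalar_mx -scalemxAr.
rewrite TT {1}TE mulmxDl !mulmxDr -!scalemxAl -!mulmxA.
rewrite (mulmxA (e^T)) ee (mulmxA (e^T)) ew (mulmxA (w^T)) we (mulmxA (w^T)) ww.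
by rewrite !mul0mx !mulmx0 scaler0 mul1mx !mul_scalar_mx -scalemxAr add0r addr0 -scalerDr -TE.
Qed.

(** T is S divided by the square root of the factor in [boost_gen_cube]; when that
    factor is zero, S = 0 and T = 0, r = 0 will do. *)
Lemma boost_gen_normalize S : boost_gen S ->
  exists T r, [/\ boost_gen T, T *m T *m T = T & S = r *: T].
Proof.
move=> bS; set a := \sum_i S i ord0 ^+ 2.
have a0 : 0 <= a by apply: sumr_ge0 => i _; exact: sqr_ge0.
have [r0|r0] := eqVneq (Num.sqrt a) 0.
  exists 0, 0; split; last first.
  - move/eqP: r0; rewrite sqrtr_eq0 le_eqVlt ltNge a0 orbF => /eqP r0.
    have S0 i : S i ord0 = 0.
      apply/eqP; rewrite -sqrf_eq0; move/eqP: r0; rewrite psumr_eq0.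
        by move=> /allP/(_ i (mem_index_enum i))/eqP ->.
      by move=> j _; exact: sqr_ge0.
    rewrite scale0r; apply/matrixP => i j; rewrite mxE.
    have sE k l : S k l = S l k by rewrite -{1}bS.1 mxE.
    have [->|j0] := eqVneq j ord0; first by rewrite S0.
    have [->|i0] := eqVneq i ord0; first by rewrite sE S0.
    by rewrite (boost_gen_even bS)// (negPf i0) (negPf j0).
  - by rewrite mulmx0.
  - by split; rewrite ?trmx0 // mulmx0 mul0mx oppr0.
exists ((Num.sqrt a)^-1 *: S), (Num.sqrt a); split; first exact: boost_genZ.
  rewrite -!scalemxAl -!scalemxAr !scalerA -scalemxAl boost_gen_cube // -/a !scalerA.
  congr (_ *: _).
  by have := sqr_sqrtr a0; move: (Num.sqrt a) r0 => r r0 <-; field.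
by rewrite scalerA divff // scale1r.
Qed.

Definition cosh (t : R) := (expR t + expR (- t)) / 2.
Definition sinh (t : R) := (expR t - expR (- t)) / 2.

Lemma cosh_sinh t : cosh t ^+ 2 - sinh t ^+ 2 = 1.
Proof. rewrite -(expRxMexpNx_1 t) /cosh /sinh; by field. Qed.

Lemma coshN t : cosh (- t) = cosh t.
Proof. by rewrite /cosh opprK addrC. Qed.

Lemma sinhN t : sinh (- t) = - sinh t.
Proof. by rewrite /sinh opprK -mulNr opprB. Qed.

(** The exponential of r t T, summed in closed form when T^3 = T. *)
Definition boost T (r t : R) : 'M[R]_p.+1 :=
  1%:M + sinh (r * t) *: T + (cosh (r * t) - 1) *: (T *m T).

Lemma boost0 T r : boost T r 0 = 1%:M.
Proof.
rewrite /boost mulr0 /sinh /cosh oppr0 subrr mul0r scale0r addr0.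
by rewrite -mulr2n -mulr_natl expR0 mulr1 divff ?pnatr_eq0// subrr scale0r addr0.
Qed.

Lemma boost_comm T r t : T *m boost T r t = boost T r t *m T.
Proof.
by rewrite /boost !mulmxDr !mulmxDl mulmx1 mul1mx -!scalemxAr -!scalemxAl mulmxA.
Qed.

Lemma boostN T r t : T *m T *m T = T ->
  boost T (- r) t *m boost T r t = 1%:M.
Proof.
move=> T3.
have T4 : T *m T *m (T *m T) = T *m T by rewrite mulmxA T3.
have := cosh_sinh (r * t); rewrite /boost mulNr coshN sinhN.
move: (cosh _) (sinh _) => c s cs.
rewrite !mulmxDl !mulmxDr !mul1mx !mulmx1 -!scalemxAl -!scalemxAr T4 T3 mulmxA T3.
move: (T *m T) => U; apply/matrixP => i j; rewrite !mxE.
apply/eqP; rewrite -subr_eq0 [X in X == 0](_ : _ = (c ^+ 2 - s ^+ 2 - 1) * U i j).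
  by rewrite cs subrr mul0r.
ring.
Qed.

Lemma lorentz_boost T r t : boost_gen T -> T *m T *m T = T ->
  lorentz (boost T r t).
Proof.
move=> [sT eT] T3; rewrite /lorentz.
have -> : (boost T r t)^T = boost T r t.
  by rewrite /boost !linearD !linearZ /= trmx_mul sT trmx1.
have -> : boost T r t *m eta = eta *m boost T (- r) t.
  have -> : boost T (- r) t = eta *m boost T r t *m eta.
    rewrite /boost mulNr coshN sinhN !mulmxDr !mulmxDl mulmx1 eta_sqr.
    have eTT : eta *m (T *m T) *m eta = T *m T.
      have : (eta *m T *m eta) *m (eta *m T *m eta) = T *m T.
        by rewrite eT mulNmx mulmxN opprK.
      by rewrite !mulmxA -(mulmxA (eta *m T)) eta_sqr mulmx1.
    by rewrite -!scalemxAr -!scalemxAl eT eTT scalerN scaleNr.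
  by rewrite !mulmxA eta_sqr mul1mx.
by rewrite -mulmxA boostN // mulmx1.
Qed.

End Lorentz.

(** * Cosets and the Cartan embedding *)

Section PseudoUnitaryTheory.
Context {R : realType} {n m : nat}.
Local Notation C := R[i].
Local Notation M := 'M[C]_(n + m).
Local Notation Lam := (Lambda R n m).
Implicit Types (P K : M) (g h : Gnm R n m).

Lemma Lambda_adj : Lam^t* = Lam.
Proof.
by rewrite /Lambda adj_block raddfN /= !trmx1 map_mxN !map_mx1.
Qed.

Lemma Lambda_sqr : Lam *m Lam = 1%:M.
Proof.
rewrite /Lambda mulmx_block !mul0mx !mulmx0 !addr0 !add0r mulmx1 mulNmx mulmxN.
by rewrite opprK mulmx1 -scalar_mx_block.
Qed.

Lemma Unm_inv P : Unm P -> P *m (Lam *m P^t* *m Lam) = 1%:M.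
Proof.
move=> [_ eP]; apply: mulmx1C.
by rewrite -!mulmxA [P^t* *m _]mulmxA eP Lambda_sqr.
Qed.

Lemma Unm_adj P : Unm P -> P *m Lam *m P^t* = Lam.
Proof.
move=> /Unm_inv e; rewrite !mulmxA in e.
by rewrite -[LHS]mulmx1 -Lambda_sqr !mulmxA e mul1mx.
Qed.

Lemma UnmP P : P^t* *m Lam *m P = Lam -> Unm P.
Proof.
move=> eP; split=> //; have := eP => /(congr1 (mulmx Lam)).
by rewrite Lambda_sqr !mulmxA => /mulmx1_unit[].
Qed.

Lemma invmx_Unm P : Unm P -> invmx P = Lam *m P^t* *m Lam.
Proof.
move=> UP; have uP := UP.1.
by rewrite -[LHS]mulmx1 -(Unm_inv UP) (mulmxA (invmx P)) mulVmx // mul1mx.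
Qed.

Lemma Unm_invmx P : Unm P -> Unm (invmx P).
Proof.
move=> UP; apply: UnmP; rewrite invmx_Unm // !adjM trmxCK Lambda_adj.
rewrite !mulmxA -(mulmxA (Lam *m P)) Lambda_sqr mulmx1.
by rewrite -!mulmxA (mulmxA P Lam) (mulmxA _ (P^t*)) Unm_adj // Lambda_sqr mulmx1.
Qed.

(** U(n) x U(m) is the unitary part of U(n,m): a unitary P preserving Lambda commutes
    with it, hence is block diagonal. *)
Lemma UnUmP P : UnUm P <-> Unm P /\ P *m P^t* = 1%:M.
Proof.
split=> [UP|[UP PP]].
  split; last by have [] := UnUmV UP.
  case: UP => a [d [/unitarymxP/mulmx1C ua /unitarymxP/mulmx1C ud ->]].
  apply: UnmP; rewrite adj_block /Lambda !mulmx_block.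
  by rewrite !(mul0mx, mulmx0, addr0, add0r, mulmx1, mulmxN, mulNmx) ua ud.
have {}UP : Lam *m P = P *m Lam.
  by have [_ e] := UP; rewrite -{2}e !mulmxA PP mul1mx.
move: UP PP; rewrite -(submxK P); move: (ulsubmx P) (ursubmx P).
move: (dlsubmx P) (drsubmx P) => c d a b.
rewrite /Lambda !mulmx_block.
rewrite !(mul0mx, mulmx0, addr0, add0r, mulmx1, mul1mx, mulmxN, mulNmx) => /eq_block_mx[_ bE cE _].
have z q r (x : 'M[C]_(q, r)) : x = - x -> x = 0.
  move=> xE; apply/eqP; have : x *+ 2 == 0 by rewrite mulr2n {2}xE subrr.
  by rewrite -scaler_nat scaler_eq0 pnatr_eq0.
rewrite (z _ _ _ (esym bE)) (z _ _ _ cE) adj_block mulmx_block.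
rewrite !mul0mx !mulmx0 !addr0 !add0r scalar_mx_block => /eq_block_mx[aE _ _ dE].
by exists a, d; split=> //; exact/unitarymxP.
Qed.

(** If g g^* = h h^*, then g^-1 h is unitary, so that it lies in U(n) x U(m). *)
Lemma coset_eqP g h : coset g = coset h <->
  gmx g *m (gmx g)^t* = gmx h *m (gmx h)^t*.
Proof.
have Ug := set_valP g; have Uh := set_valP h.
have -> : (coset g = coset h) <-> (exists2 k, UnUm k & gmx h = gmx g *m k).
  by split=> [/eqmodP/asboolP|] // H; apply/eqmodP/asboolP.
split=> [[k /UnUmP[_ kk] ->]|e].
  by rewrite adjM mulmxA -(mulmxA (gmx g)) kk mulmx1.
have ug : gmx g \in unitmx := Ug.1.
exists (invmx (gmx g) *m gmx h); last by rewrite mulmxA mulmxV // mul1mx.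
apply/UnUmP; split; first by apply: UnmM => //; exact: Unm_invmx.
rewrite adjM mulmxA -(mulmxA (invmx _)) -e mulmxA mulVmx // mul1mx.
by rewrite -adjM mulVmx // trmx1 map_mx1.
Qed.

End PseudoUnitaryTheory.

Section Cartan.
Context {R : realType} {n m : nat}.
Local Notation C := R[i].
Local Notation M := 'M[C]_(n + m).
Local Notation Lam := (Lambda R n m).

Lemma UnUm_adjM (K : M) : UnUm K -> K^t* *m K = 1%:M.
Proof. by move=> /UnUmV[_] /mulmx1C. Qed.

Lemma UnUm_Lambda (K : M) : UnUm K -> K *m Lam *m K^t* = Lam.
Proof. by move=> /UnUmP[/Unm_adj]. Qed.

Lemma UnUm_comm (K : M) : UnUm K -> Lam *m K = K *m Lam.
Proof.
by move=> UK; rewrite -{1}(UnUm_Lambda UK) -!mulmxA UnUm_adjM // mulmx1.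
Qed.

Definition mkG (P : M) (UP : Unm P) : Gnm R n m := SigSub (mem_set UP).

Lemma gmx_inj : injective (@gmx R n m).
Proof. by move=> g h /val_inj. Qed.

Definition cartan (x : Dnm R n m) : M :=
  gmx (repr x) *m (gmx (repr x))^t*.

Lemma cartanE g : cartan (coset g) = gmx g *m (gmx g)^t*.
Proof. by apply/coset_eqP; rewrite /coset; exact: reprK. Qed.

Lemma coset_repr (x : Dnm R n m) : coset (repr x) = x.
Proof. exact: reprK. Qed.

(** The hypothesis says that H is in u(n,m); its u(n) + u(m) part is skew-hermitian
    and cancels in H + H^*. *)
Lemma mspace_mpart (H : M) : H^t* *m Lam + Lam *m H = 0 ->
  H + H^t* = mpart H *+ 2 /\ mspace (mpart H).
Proof.
rewrite -(submxK H); move: (ulsubmx H) (ursubmx H) (dlsubmx H) (drsubmx H) => a b c d.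
rewrite /Lambda /mpart tr_block_mx map_block_mx !mulmx_block add_block_mx.
rewrite !(mul0mx, mulmx0, addr0, add0r, mulmx1, mul1mx, mulmxN, mulNmx).
rewrite -[X in _ = X]block_mx0 => /eq_block_mx[aE bE cE dE].
have {}aE : a + a^t* = 0 by apply/eqP; rewrite -oppr_eq0 opprD addrC aE.
have {}bE : c^t* = b by apply/eqP; rewrite -subr_eq0 bE.
have {}cE : b^t* = c by rewrite -bE trmxCK.
rewrite block_mxKur block_mxKdl; split; last by exists c => //; rewrite /hat bE.
rewrite [LHS](add_block_mx a b c d) aE bE cE [d + _]addrC dE mulr2n.
by rewrite [RHS](add_block_mx 0 b c 0) !addr0.
Qed.

Lemma mpart_mspace (B : M) : mspace B -> mpart B = B.
Proof. by move=> [X _ <-]; rewrite /mpart /hat block_mxKur block_mxKdl. Qed.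

Lemma mspace_adj (B : M) : mspace B -> B^t* = B.
Proof.
by move=> [X _ <-]; rewrite /hat tr_block_mx map_block_mx trmxCK !trmx0 !map_mx0.
Qed.

Lemma mspace_Lambda (B : M) : mspace B -> Lam *m B *m Lam = - B.
Proof.
move=> [X _ <-]; rewrite /hat /Lambda !mulmx_block.
rewrite !(mul0mx, mulmx0, addr0, add0r, mulmx1, mul1mx, mulmxN, mulNmx).
by rewrite opp_block_mx !oppr0.
Qed.

(** With F' = F H, differentiating F^* Lambda F = Lambda puts H in u(n,m), and the
    derivative F (H + H^* ) F^* of F F^* only sees the part of H in m. *)
Lemma derive_Unm (F : R -> Gnm R n m) t (H : M) :
  is_derive_mx (fun s => gmx (F s)) t (gmx (F t) *m H) ->
  is_derive_mx (fun s => cartan (coset (F s))) t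
    (gmx (F t) *m mpart H *m (gmx (F t))^t* *+ 2) /\ mspace (mpart H).
Proof.
move=> dF; have dFa := is_derive_mx_adj dF.
have isoF : (fun s => (gmx (F s))^t* *m Lam *m gmx (F s)) = fun=> Lam.
  by apply/funext => s; have [] : Unm (gmx (F s)) := set_valP (F s).
have : H^t* *m Lam + Lam *m H = 0.
  have := is_derive_mxM (is_derive_mxM dFa (is_derive_mx_cst Lam t)) dF.
  rewrite isoF => /is_derive_mx_unique/(_ (is_derive_mx_cst Lam t)).
  have gL := congr1 (@^~ t) isoF; rewrite /= -mulmxA in gL.
  rewrite mulmx0 addr0 adjM -!mulmxA (mulmxA Lam _ H) (mulmxA _ _ H).
  by rewrite !gL.
move=> /mspace_mpart[HH mB]; split=> //.
rewrite (_ : (fun _ => _) = fun s => gmx (F s) *m (gmx (F s))^t*); last first.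
  by apply/funext => s; rewrite cartanE.
have := is_derive_mxM dF dFa; rewrite adjM mulmxA -mulmxDl -mulmxDr HH.
by rewrite !mulr2n mulmxDr mulmxDl.
Qed.

(** Velocities can be compared after the Cartan embedding, whatever the lifts: this
    replaces a discussion of how lifts differ by elements of U(n) x U(m). *)
Lemma velocity_cartan c t g B : velocity c t g B ->
  [/\ c t = coset g, mspace B &
  is_derive_mx (fun s => cartan (c s)) t (gmx g *m B *m (gmx g)^t* *+ 2)].
Proof.
move=> [F [dF [cF Ft dFE ->]]].
have ug : gmx g \in unitmx := (set_valP g : Unm _).1.
have [|dK mB] := @derive_Unm F t (invmx (gmx g) *m dF).
  by rewrite Ft mulmxA mulmxV // mul1mx.
rewrite Ft in dK; split=> //.
  by have := nbhs_singleton cF; rewrite /= Ft.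
have {}cF : \forall s \near t, cartan (coset (F s)) = cartan (c s).
  by apply: filterS cF => s ->.
exact: near_eq_is_derive_mx cF dK.
Qed.

End Cartan.

(** * The orbit of the origin under the Lorentz group *)

Section HyperbolicOrbit.
Context {R : realType} {n m p : nat}.
Hypothesis n_gt0 : (0 < n)%N.
Local Notation C := R[i].
Local Notation M := 'M[C]_(n + m).
Local Notation Lam := (Lambda R n m).
Variable P : 'I_p -> 'M[C]_(m, n).
Hypothesis orthoP : forall i j, (P i)^t* *m P j = (i == j)%:R%:M.

Definition lorentz_frame (i : 'I_p.+1) : 'M[C]_(n + m, n) :=
  if unlift ord0 i is Some j then col_mx 0 (P j) else col_mx 1%:M 0.

Lemma lorentz_frame_ortho i j : (lorentz_frame i)^t* *m lorentz_frame j = (i == j)%:R%:M.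
Proof.
rewrite /lorentz_frame; case: unliftP => [i' ->|->]; case: unliftP => [j' ->|->];
  rewrite tr_col_mx map_row_mx mul_row_col ?trmx0 ?trmx1 ?map_mx0 ?map_mx1
    !(mul0mx, mulmx0, add0r, addr0).
- by rewrite orthoP (inj_eq lift_inj).
- by rewrite eq_sym (negPf (neq_lift _ _)) raddf0.
- by rewrite (negPf (neq_lift _ _)) raddf0.
- by rewrite mul1mx eqxx.
Qed.

Local Notation rho := (frame_rep lorentz_frame).
Local Notation act := (frame_mx lorentz_frame).
Local Notation rhoM := (frame_repM lorentz_frame_ortho).
Local Notation rho_act := (frame_rep_mx lorentz_frame_ortho).
Local Notation act_rho := (frame_mx_rep lorentz_frame_ortho).

(** The first frame vector spans the negative directions of Lambda, and
    eta - 1 = -2 e_00. *)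
Lemma frame_rep_eta : rho eta = Lam.
Proof.
have -> : eta = 1%:M - 2 *: delta_mx ord0 ord0 :> 'M[R]_p.+1.
  apply/matrixP => i j; rewrite !mxE.
  have [->|ij] := eqVneq i j; last first.
    have /negPf -> : ~~ ((i == ord0) && (j == ord0)).
      by apply: contra ij => /andP[/eqP -> /eqP ->].
    by rewrite mulr0n mulr0 subr0.
  by case: (j == ord0); rewrite /= ?expr0 ?expr1; ring.
rewrite /rho [X in act X]addrAC subrr add0r frame_mxN frame_mxZ.
have -> : act (delta_mx ord0 ord0) = block_mx 1%:M 0 0 0.
  rewrite /act (bigD1 ord0) //= [X in _ + X]big1 ?addr0; last first.
    move=> i i0; rewrite big1 // => j _.
    by rewrite mxE (negPf i0) /= scale0r.
  rewrite (bigD1 ord0) //= big1 ?addr0; last first.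
    by move=> j j0; rewrite mxE (negPf j0) andbF scale0r.
  rewrite mxE eqxx scale1r /lorentz_frame unlift_none tr_col_mx map_row_mx mul_col_row.
  by rewrite trmx1 map_mx1 trmx0 map_mx0 !(mul0mx, mulmx0) mulmx1.
rewrite /Lambda scalar_mx_block scale_block_mx opp_block_mx !scaler0 !oppr0.
rewrite [LHS](add_block_mx 1%:M 0 0 1%:M) !addr0; congr block_mx.
by rewrite rmorph_nat scaler_nat mulr2n opprD addNKr.
Qed.

Lemma Unm_frame_rep A : lorentz A -> Unm (rho A).
Proof.
by move=> lA; apply: UnmP; rewrite frame_rep_adj -frame_rep_eta !rhoM lA.
Qed.

Lemma hatD (X Y : 'M[C]_(m, n)) : hat (X + Y) = hat X + hat Y.
Proof.
by rewrite /hat raddfD /= map_mxD [RHS](add_block_mx 0 _ _ 0) !addr0.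
Qed.

Lemma hatZ (a : R) (X : 'M[C]_(m, n)) : hat (a%:C *: X) = a%:C *: hat X.
Proof.
rewrite /hat scale_block_mx !scaler0; congr block_mx.
apply/matrixP => i j; rewrite !mxE rmorphM; congr (_ * _); exact: conjc_real.
Qed.

Lemma hat_frame i :
  hat (P i) = lorentz_frame ord0 *m (lorentz_frame (lift ord0 i))^t* +
              lorentz_frame (lift ord0 i) *m (lorentz_frame ord0)^t*.
Proof.
rewrite /lorentz_frame unlift_none liftK /hat !tr_col_mx !map_row_mx !mul_col_row.
rewrite !trmx1 !map_mx1 !trmx0 !map_mx0 !(mul0mx, mulmx0, mulmx1, mul1mx).
by rewrite [RHS](add_block_mx 0 _ 0 0) !(addr0, add0r).
Qed.

Lemma frame_mx_hat T : boost_gen T ->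
  act T = hat (\sum_i (T ord0 (lift ord0 i))%:C *: P i).
Proof.
move=> bT.
have -> : hat (\sum_i (T ord0 (lift ord0 i))%:C *: P i) =
    \sum_i (T ord0 (lift ord0 i))%:C *: hat (P i).
  elim/big_rec2: _ => [|i x y _ <-]; last by rewrite hatD hatZ.
  by rewrite /hat trmx0 map_mx0 block_mx0.
rewrite /act big_ord_recl big_ord_recl (boost_gen_even bT)// scale0r add0r.
rewrite -big_split /=; apply: eq_bigr => i _.
rewrite big_ord_recl [X in _ + (_ + X)]big1 ?addr0 => [|j _].
  by rewrite hat_frame scalerDr -{2}bT.1 mxE.
by rewrite (boost_gen_even bT)// scale0r.
Qed.

Definition boost_gen_of (c : 'I_p -> R) : 'M[R]_p.+1 := \matrix_(i, j)
  match unlift ord0 i, unlift ord0 j with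
  | Some k, None | None, Some k => c k | _, _ => 0
  end.

Lemma boost_gen_ofP c : boost_gen (boost_gen_of c).
Proof.
split; apply/matrixP => i j.
  by rewrite !mxE; case: (unlift ord0 i) => [k|]; case: (unlift ord0 j).
rewrite eta_conjE !mxE.
case: unliftP => [k ->|->]; case: unliftP => [l ->|->];
  by rewrite ?eqxx ?(mulr0, mul0r, oppr0)//= expr0 expr1 ?mulN1r ?mulrN1 ?mulr1 ?mul1r.
Qed.

Lemma frame_mx_boost_gen_of c : act (boost_gen_of c) = hat (\sum_i (c i)%:C *: P i).
Proof.
rewrite (frame_mx_hat (boost_gen_ofP c)); congr hat; apply: eq_bigr => i _.
by rewrite mxE unlift_none liftK.
Qed.

(** A copy of hyperbolic p-space in D. *)
Definition lorentz_orbit : set (Dnm R n m) :=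
  [set x | exists2 g, x = coset g & exists2 A, lorentz A & gmx g = rho A].

Lemma lorentz_orbitP g : lorentz_orbit (coset g) <-> exists A K,
  [/\ lorentz A, UnUm K & gmx g = rho A *m K].
Proof.
split=> [[h gh [A lA hA]]|[A [K [lA UK gE]]]].
  have /eqmodP/asboolP[K UK gK] := esym gh.
  by exists A, K; split=> //; rewrite gK hA.
exists (mkG (Unm_frame_rep lA)); last by exists A.
apply/coset_eqP; rewrite gE /= adjM mulmxA -(mulmxA (rho A)).
by have [_ ->] := UnUmV UK; rewrite mulmx1.
Qed.

Let o : 'I_n := Ordinal n_gt0.

(** In the frame rho(A) instead of g = rho(A) K, the tangent vector B becomes
    an infinitesimal boost T. *)
Definition adapted g (B : M) A K T :=
  [/\ mspace B, lorentz A /\ UnUm K, gmx g = rho A *m K, boost_gen T &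
      K *m B *m K^t* = act T].

Lemma is_derive_coef (F : R -> M) t D i j : is_derive_mx F t D ->
  is_derive t (1 : R) (fun s => coef lorentz_frame o (F s) i j) (coef lorentz_frame o D i j).
Proof.
move=> dF; rewrite mxE (_ : (fun _ => _) =
  fun s => complex.Re (((lorentz_frame i)^t* *m F s *m lorentz_frame j) o o)); last first.
  by apply/funext => s; rewrite mxE.
by have [] := is_derive_mxMr (lorentz_frame j) (is_derive_mxMl ((lorentz_frame i)^t*) dF) o o.
Qed.

Lemma is_derive_frame_mx_coef (F : R -> M) t D : is_derive_mx F t D ->
  is_derive_mx (fun s => act (coef lorentz_frame o (F s))) t (act (coef lorentz_frame o D)).
Proof.
move=> dF; apply: is_derive_mx_sum => i; apply: is_derive_mx_sum => j.
by apply: is_derive_mxZ; exact: is_derive_coef.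
Qed.

(** The Cartan embedding maps the orbit into the image of a real affine map, which can
    be differentiated along curves that stay in the orbit. *)
Lemma lorentz_orbit_cartan x : lorentz_orbit x ->
  cartan x = 1%:M + act (coef lorentz_frame o (cartan x - 1%:M)).
Proof.
move=> [g -> [A lA gE]]; rewrite cartanE gE frame_rep_adj rhoM.
by rewrite {2}/frame_rep addrAC subrr add0r coef_frame_mx //; exact: lorentz_frame_ortho.
Qed.

Lemma boost_gen_frame_mx U : (act U)^t* = act U -> Lam *m act U *m Lam = - act U ->
  boost_gen U.
Proof.
move=> adjU LUL; split; apply: (frame_mx_inj lorentz_frame_ortho n_gt0).
  by rewrite -frame_mx_adj.
by rewrite -act_rho -rho_act frame_rep_eta frame_mxN.
Qed.

(** Along a curve in the orbit the derivative 2 g B g^* of the Cartan embedding is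
    in the image of frame_mx; moving it back by rho(A)^-1 keeps it there, and being
    in m it comes from an infinitesimal boost. *)
Lemma tangent_adapted g B : lorentz_orbit (coset g) -> tangent lorentz_orbit g B ->
  exists A K T, adapted g B A K T.
Proof.
move=> /lorentz_orbitP[A [K [lA UK gE]]] [e [c [e0 _ cS /velocity_cartan[_ mB dc]]]].
set D := _ *+ 2 in dc.
have DE : D = act (coef lorentz_frame o D).
  have dc1 := is_derive_mxD (is_derive_mx_cst 1%:M 0)
    (is_derive_frame_mx_coef (is_derive_mxD dc (is_derive_mx_cst (- 1%:M) 0))).
  rewrite addr0 add0r in dc1.
  apply: is_derive_mx_unique dc _; apply: near_eq_is_derive_mx dc1.
  have : (0 : R) \in `]-e, e[ by rewrite in_itv /= oppr_lt0 e0.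
  move=> /near_in_itvoo; apply: filterS => s; rewrite in_itv /= => /cS/lorentz_orbit_cartan.
  by move=> /esym.
have [A' A'A] : exists A', rho A' *m rho A = 1%:M.
  by exists (eta *m A^T *m eta); rewrite rhoM lorentz_inv // frame_rep1.
have KBK : K *m B *m K^t* = act (2^-1 *: (A' *m coef lorentz_frame o D *m A'^T)).
  rewrite frame_mxZ -act_rho -rho_act -DE -frame_rep_adj.
  have -> : rho A' *m D *m (rho A')^t* = K *m B *m K^t* + K *m B *m K^t*.
    rewrite /D gE adjM mulr2n mulmxDr mulmxDl -!mulmxA (mulmxA (rho A')) A'A.
    by rewrite mul1mx -adjM A'A trmx1 map_mx1 mulmx1.
  by rewrite scalerDr -scalerDl -rmorphD /= -[2^-1]mul1r -splitr scale1r.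
exists A, K, (2^-1 *: (A' *m coef lorentz_frame o D *m A'^T)); split=> //.
have [KV _] := UnUmV UK.
apply: boost_gen_frame_mx; rewrite -KBK; first by rewrite !adjM trmxCK (mspace_adj mB) mulmxA.
rewrite !mulmxA (UnUm_comm UK) -!mulmxA -(UnUm_comm KV).
by rewrite !mulmxA -(mulmxA K) -(mulmxA K) (mspace_Lambda mB) mulmxN mulNmx.
Qed.

Lemma is_derive_expM (r t : R) :
  is_derive t (1 : R) (fun s => expR (r * s)) (r * expR (r * t)).
Proof.
rewrite mulrC; apply: is_derive_exp_comp.
by apply: is_derive_eq (is_deriveZ r (is_derive_id t 1)) _; rewrite [_ *: _]mulr1.
Qed.

Lemma is_derive_cosh (r t : R) :
  is_derive t (1 : R) (fun s => cosh (r * s)) (r * sinh (r * t)).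
Proof.
rewrite (_ : (fun _ => _) = 2^-1 \*: ((fun s => expR (r * s)) + fun s => expR (- r * s))).
  apply: is_derive_eq (is_deriveZ _ (is_deriveD (is_derive_expM r t) (is_derive_expM (- r) t))) _.
  by rewrite /sinh /GRing.scale /= !mulNr; ring.
by apply/funext => s; rewrite /cosh -mulNr mulrC.
Qed.

Lemma is_derive_sinh (r t : R) :
  is_derive t (1 : R) (fun s => sinh (r * s)) (r * cosh (r * t)).
Proof.
rewrite (_ : (fun _ => _) = 2^-1 \*: ((fun s => expR (r * s)) - fun s => expR (- r * s))).
  apply: is_derive_eq (is_deriveZ _ (is_deriveB (is_derive_expM r t) (is_derive_expM (- r) t))) _.
  by rewrite /cosh /GRing.scale /= !mulNr; ring.
by apply/funext => s; rewrite /sinh -mulNr mulrC.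
Qed.

Lemma is_derive_boost T (r t : R) : T *m T *m T = T ->
  is_derive_mx (fun s => rho (boost T r s)) t
    (rho (boost T r t) *m act (r *: T)).
Proof.
move=> T3.
rewrite (_ : (fun _ => _) = fun s => 1%:M +
    ((sinh (r * s))%:C *: act T + (cosh (r * s) - 1)%:C *: act (T *m T))); last first.
  apply/funext => s; rewrite /frame_rep; congr (_ + _).
  by rewrite -!frame_mxZ -frame_mxD; congr (act _); rewrite /boost -(addrA 1%:M) [LHS]addrC addKr.
have -> : rho (boost T r t) *m act (r *: T) =
    0 + ((r * cosh (r * t))%:C *: act T + (r * sinh (r * t))%:C *: act (T *m T)).
  rewrite rho_act add0r -!frame_mxZ -frame_mxD; congr (act _).
  rewrite /boost -scalemxAr !mulmxDl mul1mx -!scalemxAl T3 !scalerDr !scalerA.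
  rewrite addrAC -scalerDl; congr (_ *: _ + _); ring.
have dcosh : is_derive t (1 : R) (fun s => cosh (r * s) - 1) (r * sinh (r * t)).
  apply: is_derive_eq (is_deriveB (is_derive_cosh r t) (is_derive_cst (1 : R) t (1 : R))) _.
  by rewrite subr0.
exact: is_derive_mxD (is_derive_mx_cst _ _)
  (is_derive_mxD (is_derive_mxZ _ (is_derive_sinh r t)) (is_derive_mxZ _ dcosh)).
Qed.

Lemma Unm_ray A K T r t : lorentz A -> UnUm K -> boost_gen T -> T *m T *m T = T ->
  Unm (rho (A *m boost T r t) *m K : M).
Proof.
move=> lA /UnUmP[UK _] bT T3; apply: UnmM => //; apply: Unm_frame_rep.
by apply: lorentzM => //; exact: lorentz_boost.
Qed.

Section Ray.
Variables (A T : 'M[R]_p.+1) (K : M) (r : R).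
Hypotheses (lA : lorentz A) (UK : UnUm K) (bT : boost_gen T) (T3 : T *m T *m T = T).

(** A horizontal lift of the geodesic through rho(A) K: the factor K on the right turns
    the velocity r T into the constant K^* (r T) K of m. *)
Definition ray (t : R) : Gnm R n m := mkG (Unm_ray r t lA UK bT T3).

Lemma gmx_ray t : gmx (ray t) = rho (A *m boost T r t) *m K.
Proof. by []. Qed.

Lemma lorentz_orbit_ray t : lorentz_orbit (coset (ray t)).
Proof.
apply/lorentz_orbitP; exists (A *m boost T r t), K; split=> //.
by apply: lorentzM => //; exact: lorentz_boost.
Qed.

Lemma ray0 : gmx (ray 0) = rho A *m K.
Proof. by rewrite gmx_ray boost0 mulmx1. Qed.

Lemma is_derive_ray t : is_derive_mx (fun s => gmx (ray s)) t
  (gmx (ray t) *m (K^t* *m act (r *: T) *m K)).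
Proof.
have := is_derive_mxMr K (is_derive_mxMl (rho A) (is_derive_boost r t T3)).
have [_ KK] := UnUmV UK.
rewrite (mulmxA (rho A)) [rho A *m _]rhoM.
rewrite (_ : (fun _ => _) = fun s => gmx (ray s)); last first.
  by apply/funext => s; rewrite rhoM.
by rewrite gmx_ray !mulmxA -(mulmxA _ K (K^t*)) KK mulmx1.
Qed.

End Ray.

Lemma lorentz_orbit_complete : geodesically_complete lorentz_orbit.
Proof.
move=> g B og /(tangent_adapted og)[A [K [S [mB [lA UK] gE bS KBK]]]].
have [T [r [bT T3 SE]]] := boost_gen_normalize bS.
pose F := ray r lA UK bT T3.
have BE : K^t* *m act (r *: T) *m K = B.
  by rewrite -SE -KBK !mulmxA UnUm_adjM // mul1mx -mulmxA UnUm_adjM // mulmx1.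
exists (fun t => coset (F t)); split=> [|| t]; last exact: lorentz_orbit_ray.
  exists F, (fun=> B) => t _; split=> //; last exact: is_derive_mx_cst.
  by rewrite -BE; exact: is_derive_ray.
have F0 : F 0 = g by apply: gmx_inj; rewrite gE; exact: ray0.
exists F, (gmx g *m B); split=> //.
- by apply: filterE => s.
- by rewrite -F0 -BE; exact: is_derive_ray.
- have ug : gmx g \in unitmx := (set_valP g : Unm _).1.
  by rewrite mulmxA mulVmx // mul1mx mpart_mspace.
Qed.

(** A horizontal lift F of a geodesic has F' = F D with D constant.  Writing
    F(0) = rho(A) L, the derivative of F(t) L^* rho(exp(-t r T)) is zero, so that
    F(t) = rho(A exp(t r T)) L for as long as the geodesic is given. *)
Lemma lorentz_orbit_totally_geodesic : totally_geodesic lorentz_orbit.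
Proof.
move=> g B e c og /(tangent_adapted og)[A [K [S [mB [lA UK] gE bS KBK]]]] e0.
move=> [F [D geo]] /velocity_cartan[c0 _ dc].
have [T [r [bT T3 SE]]] := boost_gen_normalize bS.
have in_e t : - e < t < e -> `]-e, e[%classic t by rewrite /= in_itv.
have e00 : - e < 0 < e by rewrite oppr_lt0 e0.
have near_e : \forall t \near (0 : R), - e < t < e.
  have : (0 : R) \in `]-e, e[ by rewrite in_itv.
  by move=> /near_in_itvoo; apply: filterS => s; rewrite in_itv.
have DE t : - e < t < e -> D t = D 0.
  by apply: derive0_mx_constant => s /in_e/geo[].
have [cF0 mD dF _] := geo 0 (in_e _ e00).
have gF0 : coset g = coset (F 0) by rewrite -c0 cF0.
have /eqmodP/asboolP[k Uk hE] := gF0.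
(* Both sides are half the derivative at 0 of the Cartan embedding along c. *)
have gD : gmx g *m B *m (gmx g)^t* = gmx (F 0) *m D 0 *m (gmx (F 0))^t*.
  have [dK _] := derive_Unm dF; rewrite mpart_mspace // in dK.
  have cFE : \forall s \near (0 : R), cartan (coset (F s)) = cartan (c s).
    by apply: filterS near_e => s /in_e/geo[->].
  have := is_derive_mx_unique dc (near_eq_is_derive_mx cFE dK).
  have half (Z : M) : (2^-1 : C) *: (Z *+ 2) = Z.
    by rewrite mulr2n scalerDr -scalerDl -[2^-1]mul1r -splitr scale1r.
  by move=> /(congr1 (fun Z : M => (2^-1 : C) *: Z)); rewrite !half.
have kDk : k *m D 0 *m k^t* = B.
  have gg : invmx (gmx g) *m gmx g = 1%:M by rewrite mulVmx // (set_valP g : Unm _).1.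
  have gg' : (gmx g)^t* *m (invmx (gmx g))^t* = 1%:M.
    by rewrite -adjM gg trmx1 map_mx1.
  have := congr1 (fun Z => invmx (gmx g) *m Z *m (invmx (gmx g))^t*) gD.
  rewrite hE adjM -!mulmxA gg' !mulmx1 (mulmxA (invmx _)) gg mul1mx => ->.
  by rewrite (mulmxA (invmx _)) gg mul1mx.
have [L [UL LDL FL]] : exists L, [/\ UnUm L, L *m D 0 *m L^t* = act S &
    gmx (F 0) = rho A *m L].
  exists (K *m k); split; [exact: UnUmM| |by rewrite hE gE mulmxA].
  by rewrite -KBK -kDk adjM !mulmxA.
have D0E : D 0 *m L^t* = L^t* *m act S.
  by rewrite -LDL !mulmxA UnUm_adjM // mul1mx.
have rayE t : - e < t < e -> F t = ray r lA UL bT T3 t.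
  move=> te; apply: gmx_inj; rewrite gmx_ray.
  pose G s := gmx (F s) *m L^t* *m rho (boost T (- r) s).
  have GE : G t = rho A.
    have -> : G t = G 0.
      apply: (@derive0_mx_constant _ _ _ G e) => // s se.
      have [_ _ dFs _] := geo s (in_e _ se); rewrite DE // in dFs.
      have := is_derive_mxM (is_derive_mxMr (L^t*) dFs)
        (is_derive_boost (- r) s T3).
      suff -> : gmx (F s) *m D 0 *m L^t* *m rho (boost T (- r) s) +
        gmx (F s) *m L^t* *m (rho (boost T (- r) s) *m act (- r *: T)) = 0 by [].
      rewrite -(mulmxA (gmx _) (D 0)) D0E SE scaleNr frame_mxN !mulmxN -!mulmxA.
      by rewrite act_rho rho_act -scalemxAl -scalemxAr boost_comm subrr.
    by rewrite /G boost0 frame_rep1 mulmx1 FL -mulmxA (UnUmV UL).2 mulmx1.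
  rewrite -rhoM -GE /G -(mulmxA _ (rho (boost T (- r) t))) rhoM boostN // frame_rep1 mulmx1.
  by rewrite -mulmxA UnUm_adjM // mulmx1.
apply: filterS near_e => t te; have [-> _ _ _] := geo t (in_e _ te).
by rewrite rayE //; exact: lorentz_orbit_ray.
Qed.

(** The entries are real affine functions of those of A. *)
Lemma elementary_frame_rep (V : normedModType R) (A : V -> 'M[R]_p.+1) i j :
  (forall k l, elementary (fun x => A x k l)) ->
  elementary (fun x => complex.Re (rho (A x) i j)) /\
  elementary (fun x => complex.Im (rho (A x) i j)).
Proof.
move=> eA; have eS (a : R) (b : 'I_p.+1 -> 'I_p.+1 -> R) :
    elementary (fun x => a + \sum_k \sum_l b k l * (A x k l - (1%:M : 'M[R]_p.+1) k l)).
  apply: elementaryD; first exact: elementary_cst.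
  apply: elementary_sum => k; apply: elementary_sum => l.
  apply: elementaryM; first exact: elementary_cst.
  by apply: elementaryD => //; exact: elementary_cst.
split.
- rewrite (_ : (fun _ => _) = fun x => complex.Re ((1%:M : M) i j) +
    \sum_k \sum_l complex.Re ((lorentz_frame k *m (lorentz_frame l)^t*) i j) *
      (A x k l - (1%:M : 'M[R]_p.+1) k l)); first exact: eS.
  apply/funext => x; rewrite /frame_rep mxE ReD; congr (_ + _).
  rewrite summxE Re_sum; apply: eq_bigr => k _; rewrite summxE Re_sum.
  by apply: eq_bigr => l _; rewrite mxE ReZ !mxE.
- rewrite (_ : (fun _ => _) = fun x => complex.Im ((1%:M : M) i j) +
    \sum_k \sum_l complex.Im ((lorentz_frame k *m (lorentz_frame l)^t*) i j) *
      (A x k l - (1%:M : 'M[R]_p.+1) k l)); first exact: eS.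
  apply/funext => x; rewrite /frame_rep mxE ImD; congr (_ + _).
  rewrite summxE Im_sum; apply: eq_bigr => k _; rewrite summxE Im_sum.
  by apply: eq_bigr => l _; rewrite mxE ImZ !mxE.
Qed.

Lemma smooth_frame_rep (V : normedModType R) (U : set V)
    (A : V -> 'M[R]_p.+1) : (forall i j, elementary (fun x => A x i j)) ->
  smooth_mx U (fun x => rho (A x)).
Proof.
by move=> eA i j; have [eR eI] := elementary_frame_rep i j eA; split; exact: elementary_smooth.
Qed.

Lemma elementary_boost (T : 'M[R]_p.+1) (r : R) i j : elementary (fun t => boost T r t i j).
Proof.
have el (s : R) : elementary (fun t : R => expR (s * t)).
  apply/elementary_exp/elementary_lin; last exact: mulrl_continuous.
  by move=> a x y; rewrite mulrDr mulrCA.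
rewrite (_ : (fun _ => _) = fun t : R =>
  (1%:M : 'M[R]_p.+1) i j + (expR (r * t) + - expR (- r * t)) * (2^-1 * T i j) +
  ((expR (r * t) + expR (- r * t)) * 2^-1 + -1) * (T *m T) i j).
  apply: elementaryD; [apply: elementaryD|apply: elementaryM]; try exact: elementary_cst.
    apply: elementaryM; last exact: elementary_cst.
    by apply: elementaryD; [exact: el|apply: elementaryN; exact: el].
  apply: elementaryD; last exact: elementary_cst.
  by apply: elementaryM; [apply: elementaryD; exact: el|exact: elementary_cst].
apply/funext => t; rewrite /boost /cosh /sinh !mulNr.
by move: (T *m T) => U; rewrite !mxE mulrA.
Qed.

Lemma tangent_lorentz_orbit :
  tangent lorentz_orbit (G1 R n m) = [set B | exists2 T, boost_gen T & B = act T].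
Proof.
have gmxG1 : gmx (G1 R n m) = 1%:M by [].
have orbit1 : lorentz_orbit (coset (G1 R n m)).
  exists (G1 R n m) => //; exists 1%:M; first exact: lorentz1.
  by rewrite frame_rep1.
apply/seteqP; split=> [B /(tangent_adapted orbit1)|_ [S bS ->]].
  move=> [A [K [T [mB [lA UK] AK bT KBK]]]].
  rewrite gmxG1 in AK; have KE : K = rho (eta *m A^T *m eta).
    have A'A : rho (eta *m A^T *m eta) *m rho A = 1%:M.
      by rewrite rhoM lorentz_inv // frame_rep1.
    by rewrite -[LHS]mul1mx -A'A -mulmxA -AK mulmx1.
  have BE : B = act ((eta *m A^T *m eta)^T *m T *m (eta *m A^T *m eta)).
    rewrite -act_rho -rho_act -frame_rep_adj -KE -KBK !mulmxA UnUm_adjM // mul1mx.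
    by rewrite -mulmxA UnUm_adjM // mulmx1.
  rewrite BE; eexists; last by [].
  apply: boost_gen_frame_mx; rewrite -BE; [exact: mspace_adj|exact: mspace_Lambda].
have [T [r [bT T3 SE]]] := boost_gen_normalize bS.
have U1 : UnUm (1%:M : M) := UnUm1 R n m.
pose F := ray r lorentz1 U1 bT T3.
have F0 : F 0 = G1 R n m.
  by apply: gmx_inj; rewrite [LHS]ray0 frame_rep1 mul1mx.
exists 1, (fun t => coset (F t)); split=> //.
- move=> t _; exists setT, F; split=> //; first exact: openT.
  rewrite (_ : (fun _ => _) = fun t => rho (boost T r t)); last first.
    by apply/funext => s; rewrite gmx_ray mulmx1 mul1mx.
  by apply: smooth_frame_rep => i j; exact: elementary_boost.
- by move=> t _; exact: lorentz_orbit_ray.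
- exists F, (act S); split=> //.
  + by apply: filterE => s.
  + have := is_derive_ray r lorentz1 U1 bT T3 0; rewrite -/F.
    by rewrite [X in gmx X *m _]F0 gmxG1 mul1mx trmx1 map_mx1 mul1mx mulmx1 -SE.
  + by rewrite gmxG1 invmx1 mul1mx mpart_mspace // (frame_mx_hat bS); eexists.
Qed.

End HyperbolicOrbit.

(** * Topology of the coset space *)

Section ContinuousMatrix.
Context {R : realType} {T : topologicalType}.
Local Notation C := R[i].

Lemma complex_normE (a b : R) : `|a%:C - b%:C| = `|a - b|%:C :> C.
Proof.
by rewrite -raddfB normc_def /= expr0n addr0 sqrtr_sqr.
Qed.

Lemma continuous_Re : continuous (fun z : C => complex.Re z : R).
Proof.
move=> z A [e e0 eA]; exists e%:C => [|w zw]; first by rewrite /= ltcR.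
apply: eA; rewrite /ball_ /= -ltcR; apply: le_lt_trans zw.
rewrite (_ : complex.Re z - complex.Re w = complex.Re (z - w)) ?normc_ge_Re //.
by case: z w => ? ? [].
Qed.

Lemma continuous_Im : continuous (fun z : C => complex.Im z : R).
Proof.
rewrite (_ : (fun _ => _) = fun z : C => complex.Re (- 'i%C * z)); last first.
  by apply/funext => -[a b] /=; ring.
move=> z; apply: (@continuous_comp _ _ _ (fun z : C => - 'i%C * z)); last exact: continuous_Re.
exact: mulrl_continuous.
Qed.

Lemma continuous_complex (a b : T -> R) x : {for x, continuous a} ->
  {for x, continuous b} -> {for x, continuous (fun y => (a y) +i* (b y) : C)}.
Proof.
have cRC : continuous (fun r : R => r%:C : C).
  move=> r A [e e0 eA]; have eE : e = (complex.Re e)%:C by rewrite RRe_real // gtr0_real.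
  rewrite /= eE ltcR in e0; exists (complex.Re e) => // s rs.
  by apply: eA; rewrite /ball_ /= complex_normE eE ltcR.
move=> ca cb; rewrite (_ : (fun _ => _) = fun y => (a y)%:C + 'i%C * (b y)%:C); last first.
  apply/funext => y; apply/eqP; rewrite eq_complex /=. 
  by apply/andP; split; apply/eqP; ring.
apply: continuousD; first exact: continuous_comp ca (cRC _).
apply: continuousM; first exact: cst_continuous.
exact: continuous_comp cb (cRC _).
Qed.

Lemma continuous_mx (K : topologicalType) p q (F : T -> 'M[K]_(p, q)) x :
  (forall i j, {for x, continuous (fun y => F y i j)}) -> {for x, continuous F}.
Proof.
move=> cF A [P nP PA]; apply: (@filterS _ _ _ (fun y => forall i j, P i j (F y i j))).
  by move=> y Py; apply: PA.
apply: filter_forall => i; apply: filter_forall => j; exact: cF (nP i j).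
Qed.

(** Continuity of complex matrices through real functions, which fits the real-valued
    coefficients that are extracted from them. *)
Definition continuous_entries p q (F : T -> 'M[C]_(p, q)) := forall i j,
  continuous (fun x => complex.Re (F x i j)) /\
  continuous (fun x => complex.Im (F x i j)).

Lemma continuous_entries_cst p q (A : 'M[C]_(p, q)) : continuous_entries (fun=> A).
Proof. by move=> i j; split=> x; exact: cvg_cst. Qed.

Lemma continuous_entriesM p q r (F : T -> 'M[C]_(p, q)) (G : T -> 'M[C]_(q, r)) :
  continuous_entries F -> continuous_entries G ->
  continuous_entries (fun x => F x *m G x).
Proof.
move=> cF cG i j.
have csum (f : 'I_q -> T -> R) : (forall k, continuous (f k)) ->
    continuous (fun x => \sum_k f k x).
  move=> cf; rewrite (_ : (fun _ => _) = \sum_k f k); last first.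
    by apply/funext => x; rewrite fct_sumE.
  elim/big_ind: _ => [|u v cu cv|k _]; last exact: cf.
    by move=> x; exact: cvg_cst.
  by move=> x; apply: continuousD; [exact: cu|exact: cv].
split.
- rewrite (_ : (fun _ => _) = fun x => \sum_k
    (complex.Re (F x i k) * complex.Re (G x k j) -
     complex.Im (F x i k) * complex.Im (G x k j))).
    apply: csum => k x; have [rF iF] := cF i k; have [rG iG] := cG k j.
    exact: continuousB (continuousM (rF x) (rG x)) (continuousM (iF x) (iG x)).
  apply/funext => x; rewrite mxE Re_sum; apply: eq_bigr => k _.
  by rewrite ReM.
- rewrite (_ : (fun _ => _) = fun x => \sum_k
    (complex.Re (F x i k) * complex.Im (G x k j) +
     complex.Im (F x i k) * complex.Re (G x k j))).
    apply: csum => k x; have [rF iF] := cF i k; have [rG iG] := cG k j.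
    exact: continuousD (continuousM (rF x) (iG x)) (continuousM (iF x) (rG x)).
  apply/funext => x; rewrite mxE Im_sum; apply: eq_bigr => k _.
  by rewrite ImM.
Qed.

Lemma continuous_entries_adj p q (F : T -> 'M[C]_(p, q)) :
  continuous_entries F -> continuous_entries (fun x => (F x)^t*).
Proof.
move=> cF i j; have [rF iF] := cF j i; split.
- by rewrite (_ : (fun _ => _) = fun x => complex.Re (F x j i)) //;
    apply/funext => x; rewrite !mxE ReJ.
- rewrite (_ : (fun _ => _) = fun x => - complex.Im (F x j i)).
    by move=> x; exact: continuousN (iF x).
  by apply/funext => x; rewrite !mxE ImJ.
Qed.

End ContinuousMatrix.

Section Topology.
Context {R : realType} {n m : nat}.
Local Notation C := R[i].

Lemma continuous_gmx : continuous (@gmx R n m).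
Proof. exact: initial_continuous. Qed.

Lemma continuous_to_Gnm (T : topologicalType) (F : T -> Gnm R n m) :
  (forall i j, continuous (fun x => gmx (F x) i j)) -> continuous F.
Proof.
move=> cF x A [_ [[B oB <-] Bx BA]].
have nB := continuous_mx (fun i j => cF i j x) (open_nbhs_nbhs (conj oB Bx)).
by apply: (@filterS _ (nbhs x) _ _ (F @^-1` A) _ nB) => y By; exact: BA.
Qed.

Lemma continuous_coset : continuous (@coset R n m).
Proof. exact: pi_continuous. Qed.

Lemma continuous_entries_gmx : continuous_entries (@gmx R n m).
Proof.
move=> i j; have cg : continuous (fun g : Gnm R n m => gmx g i j).
  move=> g; apply: (@continuous_comp _ _ _ (@gmx R n m) (fun M => M i j)).
    exact: continuous_gmx.
  exact: coord_continuous.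
by split=> g; [apply: (@continuous_comp _ _ _ _ (fun z : C => complex.Re z)) (cg g) _
  |apply: (@continuous_comp _ _ _ _ (fun z : C => complex.Im z)) (cg g) _];
  [exact: continuous_Re|exact: continuous_Im].
Qed.

(** g g^* is a continuous function of g that is constant on cosets, so it descends to
    the quotient topology. *)
Lemma continuous_cartan_coef k (E : 'I_k -> 'M[C]_(n + m, n)) o i j :
  continuous (fun x : Dnm R n m => coef E o (cartan x) i j).
Proof.
apply/quotient_continuous.
rewrite (_ : _ \o _ = fun g => complex.Re (((E i)^t* *m
  (gmx g *m (gmx g)^t*) *m E j) o o)); last first.
  by apply/funext => g; rewrite /= -/(coset g) cartanE mxE.
have := continuous_entriesM (continuous_entriesM
  (continuous_entries_cst ((E i)^t*)) (continuous_entriesM continuous_entries_gmx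
  (continuous_entries_adj continuous_entries_gmx))) (continuous_entries_cst (E j)).
by move=> /(_ o o)[].
Qed.

End Topology.

(** * Horospherical coordinates on the hyperbolic plane *)

Section Iwasawa.
Context {R : realType}.

Definition mx3 (rows : seq (seq R)) : 'M[R]_3 :=
  \matrix_(i, j) nth 0 (nth [::] rows i) j.

Lemma ord3P (Q : 'I_3 -> Prop) : Q 0 -> Q 1 -> Q 2 -> forall i, Q i.
Proof.
move=> Q0 Q1 Q2 [[|[|[|//]]] i3].
- by have -> : Ordinal i3 = 0 by apply: val_inj.
- by have -> : Ordinal i3 = 1 by apply: val_inj.
- by have -> : Ordinal i3 = 2 by apply: val_inj.
Qed.

(** The product n(x) a(s) of the parabolic n(x), which fixes the null vector
    p = (1,1,0) and maps e_2 to e_2 + x p and q = (1,-1,0) to q + 2 x e_2 + x^2 p,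
    with the boost a(s) that multiplies p by exp(s) and q by exp(-s). *)
Definition iwasawa (s x : R) : 'M[R]_3 :=
  let a := expR s in let b := expR (- s) in mx3
  [:: [:: (a + b * (1 + x ^+ 2)) / 2; (a - b - b * x ^+ 2) / 2; x];
      [:: (a - b + b * x ^+ 2) / 2; (a + b - b * x ^+ 2) / 2; x];
      [:: b * x; - (b * x); 1]].

Lemma lorentz_iwasawa s x : lorentz (iwasawa s x).
Proof.
rewrite /lorentz /iwasawa; have ab := expRxMexpNx_1 s.
move: (expR s) (expR (- s)) ab => a b ab.
have a0 : a != 0 by apply: contra_eq_neq ab => ->; rewrite mul0r eq_sym oner_neq0.
have ba : b = a^-1 by rewrite -[RHS]mulr1 -ab mulKf.
rewrite /eta mul_mx_diag; apply/matrixP => i j.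
rewrite !mxE !big_ord_recl big_ord0 !mxE /= ba.
by move: i j; apply: ord3P; apply: ord3P; rewrite /= ?expr0 ?expr1; field.
Qed.

(** For M = A A^T with A = iwasawa s x, these two are half the squared norm of the
    difference of the first two rows, which is exp(-s) (1, -1, 0), and half its product
    with the third row; they determine s and x. *)
Definition horo_height (M : 'M[R]_3) : R := (M 0 0 - M 0 1 - M 1 0 + M 1 1) / 2.
Definition horo_shift (M : 'M[R]_3) : R := (M 0 2 - M 1 2) / 2.

Lemma horo_height_iwasawa s x :
  horo_height (iwasawa s x *m (iwasawa s x)^T) = expR (- s) ^+ 2.
Proof.
rewrite /horo_height !mxE !big_ord_recl !big_ord0 !mxE /=.
by field.
Qed.

Lemma horo_shift_iwasawa s x :
  horo_shift (iwasawa s x *m (iwasawa s x)^T) = expR (- s) ^+ 2 * x.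
Proof.
rewrite /horo_shift !mxE !big_ord_recl !big_ord0 !mxE /=.
by field.
Qed.

(** A A^T = A (eta + 2 e e^T) A^T depends only on the point A e of the hyperboloid. *)
Lemma lorentz_sqr p (A : 'M[R]_p.+1) : lorentz A ->
  A *m A^T =
  eta + (col ord0 A *m (col ord0 A)^T + col ord0 A *m (col ord0 A)^T).
Proof.
move=> /lorentz_tr lA.
have -> : A *m A^T = A *m (eta + (delta_mx ord0 ord0 + delta_mx ord0 ord0)) *m A^T.
  rewrite (_ : eta + _ = 1%:M) ?mulmx1 //; apply/matrixP => i j; rewrite !mxE.
  have [->|ij] := eqVneq i j.
    by case: (j == ord0); rewrite /= ?expr0 ?expr1 ?addr0 //; ring.
  have /negPf -> : ~~ ((i == ord0) && (j == ord0)).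
    by apply: contra ij => /andP[/eqP -> /eqP ->].
  by rewrite !mulr0n !addr0.
rewrite mulmxDr mulmxDl lA mulmxDr mulmxDl; congr (_ + (_ + _));
  by rewrite -(mul_delta_mx (ord0 : 'I_1)) mulmxA -colE -mulmxA -trmx_delta -trmx_mul -colE.
Qed.

(** Up to sign, which A A^T does not see, the first column b of A satisfies
    b_0 > b_1, and then s, x are read off from b_0 - b_1 = exp(-s), b_2 = exp(-s) x. *)
Lemma iwasawa_surj A : lorentz A -> exists s x,
  iwasawa s x *m (iwasawa s x)^T = A *m A^T.
Proof.
move=> lA.
have [b [bE b_gt0 bn]] : exists b : 'cV[R]_3, [/\ b *m b^T = col ord0 A *m (col ord0 A)^T,
    0 < b 0 0 - b 1 0 & (b 0 0 - b 1 0) * (b 0 0 + b 1 0) = 1 + b 2 0 ^+ 2].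
  pose a := col ord0 A.
  have aa : (a 0 0 - a 1 0) * (a 0 0 + a 1 0) = 1 + a 2 0 ^+ 2.
    have /matrixP/(_ 0 0) := lA; rewrite /eta mul_mx_diag !mxE !big_ord_recl big_ord0 !mxE /=.
    rewrite !expr0 !expr1 /= => e.
    rewrite (_ : lift ord0 (lift ord0 ord0) = 2) in e; last exact: val_inj.
    rewrite (_ : lift ord0 ord0 = 1) in e; last exact: val_inj.
    move: e; rewrite -!/(0 : 'I_3); move: (A 0 0) (A 1 0) (A 2 0) => x y z e.
    by lra.
  have a0 : a 0 0 - a 1 0 != 0.
    apply/negP => /eqP az; move: aa; rewrite az mul0r => /eqP.
    by rewrite eq_sym gt_eqF // ltr_pwDl // sqr_ge0.
  have [a_gt0|a_lt0|/eqP] := ltgtP 0 (a 0 0 - a 1 0); last by rewrite eq_sym (negPf a0).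
    by exists a.
  exists (- a); split; first by rewrite linearN /= mulNmx mulmxN opprK.
    move: a_lt0; rewrite !mxE. lra.
  by move: aa; rewrite !mxE => aa; lra.
exists (- ln (b 0 0 - b 1 0)), (b 2 0 / (b 0 0 - b 1 0)).
rewrite !lorentz_sqr //; last exact: lorentz_iwasawa.
rewrite -bE; set c := col _ _; suff -> : c = b by [].
rewrite /c; apply/colP; rewrite /iwasawa opprK expRN lnK ?posrE //.
apply: ord3P; rewrite !mxE /=; move: b_gt0 bn;
  move: (b 0 0) (b 1 0) (b 2 0) => b0 b1 b2 b_gt0 bn;
  have b_neq0 : b0 - b1 != 0 by rewrite gt_eqF.
- rewrite [X in X / 2](_ : _ = (1 + b2 ^+ 2) / (b0 - b1) + (b0 - b1)); last by field.
  by rewrite -bn; field.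
- rewrite [X in X / 2](_ : _ = (1 + b2 ^+ 2) / (b0 - b1) - (b0 - b1)); last by field.
  by rewrite -bn; field.
- by field.
Qed.

End Iwasawa.

(** * The orbit as an embedded surface *)

Section Surface.
Context {R : realType} {n m : nat}.
Hypothesis n_gt0 : (0 < n)%N.
Local Notation C := R[i].
Variable P : 'I_2 -> 'M[C]_(m, n).
Hypothesis orthoP : forall i j, (P i)^t* *m P j = (i == j)%:R%:M.
Local Notation frameP := (lorentz_frame_ortho orthoP).
Local Notation o := (Ordinal n_gt0).

Definition chart_lift (u : 'rV[R]_2) : Gnm R n m :=
  mkG (Unm_frame_rep orthoP (lorentz_iwasawa (u 0 0) (u 0 1))).

Lemma gmx_chart_lift u :
  gmx (chart_lift u) = frame_rep (lorentz_frame P) (iwasawa (u 0 0) (u 0 1)).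
Proof. by []. Qed.

Definition chart (u : 'rV[R]_2) : Dnm R n m := coset (chart_lift u).

Lemma range_chart : range chart = lorentz_orbit P.
Proof.
apply/seteqP; split=> [_ [u _ <-]|_ [g -> [A lA gE]]].
  exists (chart_lift u) => //; exists (iwasawa (u 0 0) (u 0 1)) => //.
  exact: lorentz_iwasawa.
have [s [x sxE]] := iwasawa_surj lA.
exists (\row_i (if i == 0 then s else x)) => //; apply/coset_eqP.
by rewrite gmx_chart_lift !mxE gE !frame_rep_adj !(frame_repM frameP) sxE.
Qed.

Definition gram (p : Dnm R n m) : 'M[R]_3 := coef (lorentz_frame P) o (cartan p).

Lemma gram_chart u :
  gram (chart u) = iwasawa (u 0 0) (u 0 1) *m (iwasawa (u 0 0) (u 0 1))^T.
Proof.
rewrite /gram /chart cartanE gmx_chart_lift frame_rep_adj.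
by rewrite (frame_repM frameP) (coef_frame_rep frameP).
Qed.

Lemma horo_height_chart u : horo_height (gram (chart u)) = expR (- u 0 0) ^+ 2.
Proof. by rewrite gram_chart horo_height_iwasawa. Qed.

Lemma horo_shift_chart u : horo_shift (gram (chart u)) = expR (- u 0 0) ^+ 2 * u 0 1.
Proof. by rewrite gram_chart horo_shift_iwasawa. Qed.

Definition chart_inv (p : Dnm R n m) : 'rV[R]_2 :=
  \row_i (if i == 0 then - ln (horo_height (gram p)) / 2
          else horo_shift (gram p) / horo_height (gram p)).

Lemma rV2P (u v : 'rV[R]_2) : u 0 0 = v 0 0 -> u 0 1 = v 0 1 -> u = v.
Proof.
move=> e0 e1; apply/rowP => -[[|[|//]] i2].
- by have -> : Ordinal i2 = 0 by apply: val_inj.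
- by have -> : Ordinal i2 = 1 by apply: val_inj.
Qed.

Lemma chartK : cancel chart chart_inv.
Proof.
move=> u; apply: rV2P; rewrite mxE /= horo_height_chart ?horo_shift_chart.
  rewrite lnXn ?expR_gt0 // expRK. by rewrite mulr2n; lra.
by rewrite mulrAC mulfV ?mul1r // sqrf_eq0 gt_eqF // expR_gt0.
Qed.

Lemma continuous_gram i j : continuous (fun p => gram p i j).
Proof. exact: continuous_cartan_coef. Qed.

Lemma continuous_horo_height : continuous (fun p => horo_height (gram p)).
Proof.
move=> p.
have c1 := continuousB (@continuous_gram 0 0 p) (@continuous_gram 0 1 p).
have c2 := continuousB c1 (@continuous_gram 1 0 p).
have c3 := continuousD c2 (@continuous_gram 1 1 p).
exact: continuousM c3 (@cvg_cst _ (2^-1 : R) _ (nbhs p) _).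
Qed.

Lemma continuous_horo_shift : continuous (fun p => horo_shift (gram p)).
Proof.
move=> p.
have c1 := continuousB (@continuous_gram 0 2 p) (@continuous_gram 1 2 p).
exact: continuousM c1 (@cvg_cst _ (2^-1 : R) _ (nbhs p) _).
Qed.

Lemma continuous_chart_inv p : 0 < horo_height (gram p) -> {for p, continuous chart_inv}.
Proof.
move=> ap; apply: continuous_mx => i j.
have -> : (fun q => chart_inv q i j) = if j == 0
    then fun q => - ln (horo_height (gram q)) / 2
    else fun q => horo_shift (gram q) / horo_height (gram q).
  by apply/funext => q; rewrite mxE; case: (j == 0).
case: (j == 0); last first.
  have cV : {for p, continuous (fun q => (horo_height (gram q))^-1)}.
    by apply: continuousV; [rewrite gt_eqF|exact: continuous_horo_height].
  exact: continuousM (@continuous_horo_shift p) cV.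
have cl : {for p, continuous (fun q => ln (horo_height (gram q)))}.
  apply: (@continuous_comp _ _ _ (fun q => horo_height (gram q)) (@ln R)).
    exact: continuous_horo_height.
  exact: continuous_ln.
exact: continuousM (continuousN cl) (@cvg_cst _ (2^-1 : R) _ (nbhs p) _).
Qed.

(** The inverse chart extends to all of D and is continuous where the height is
    positive, in particular near the orbit; hence the orbit meets the preimage of U and
    the interior of that preimage in the same points. *)
Lemma chart_open (U : set 'rV[R]_2) : open U ->
  exists2 W, open W & chart @` U = lorentz_orbit P `&` W.
Proof.
move=> oU; exists (chart_inv @^-1` U `&` [set p | 0 < horo_height (gram p)])°.
  exact: open_interior.
apply/seteqP; split=> [_ [u Uu <-]|p [Sp /interior_subset[]]].
  split; first by rewrite -range_chart; exists u.
  have a_gt0 : 0 < horo_height (gram (chart u)) by rewrite horo_height_chart exprn_gt0 // expR_gt0.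
  apply: filterI.
    apply: (continuous_chart_inv a_gt0); rewrite chartK.
    exact: (open_nbhs_nbhs (conj oU Uu)).
  have o_gt0 : open [set r : R | 0 < r] by exact: open_gt.
  exact: (@continuous_horo_height (chart u) _ (open_nbhs_nbhs (conj o_gt0 a_gt0))).
by move: Sp; rewrite -range_chart => -[u _ <-] /=; rewrite chartK => Uu _; exists u.
Qed.

Lemma elementary_iwasawa i j :
  elementary (fun u : 'rV[R]_2 => iwasawa (u 0 0) (u 0 1) i j).
Proof.
have el k : elementary (fun u : 'rV[R]_2 => u 0 k).
  apply: elementary_lin; last exact: coord_continuous.
  by move=> a u v; rewrite !mxE.
have ee : elementary (fun u : 'rV[R]_2 => expR (u 0 0)) by exact: elementary_exp.
have eN : elementary (fun u : 'rV[R]_2 => expR (- u 0 0)).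
  by apply: elementary_exp; exact: elementaryN.
rewrite /iwasawa; under eq_fun do rewrite mxE.
move: i j; apply: ord3P; apply: ord3P => /=;
  repeat first [exact: el|exact: ee|exact: eN|exact: elementary_cst
    |apply: elementaryD|apply: elementaryM|apply: elementaryN].
Qed.

Lemma chart_smooth : smooth_map setT chart.
Proof.
move=> u _; exists setT, chart_lift; split=> //; first exact: openT.
by apply: smooth_frame_rep => i j; exact: elementary_iwasawa.
Qed.

Lemma continuous_chart : continuous chart.
Proof.
move=> u; apply: (@continuous_comp _ _ _ chart_lift (@coset R n m)).
  apply: continuous_to_Gnm => i j v.
  have [eR eI] := elementary_frame_rep P i j elementary_iwasawa.
  have := continuous_complex (elementary_continuous eR (x := v))
    (elementary_continuous eI (x := v)).
  rewrite (_ : (fun _ => _) = fun w => gmx (chart_lift w) i j) //.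
  by apply/funext => w; rewrite gmx_chart_lift; case: (frame_rep _ _ _ _).
exact: continuous_coset.
Qed.

(** The plane is a union of lines through 0, and the chart is continuous. *)
Lemma lorentz_orbit_connected : connected (lorentz_orbit P).
Proof.
rewrite -range_chart; apply: connected_continuous_connected; last first.
  exact/continuous_subspaceT/continuous_chart.
have -> : [set: 'rV[R]_2] = \bigcup_v range (fun t : R => t *: v).
  apply/seteqP; split=> [v _|//]; exists v => //; exists 1 => //.
  by rewrite scale1r.
apply: bigcup_connected; first by exists 0 => v _; exists 0; rewrite ?scale0r.
move=> v _; apply: connected_continuous_connected.
  by apply/connected_intervalP.
apply: continuous_subspaceT => t; exact: scalel_continuous.
Qed.

(** A vanishing velocity makes the derivatives of exp(-2s) and exp(-2s) x vanish along
    the line u + t v, whence v = 0. *)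
Lemma chart_immersion (u v : 'rV[R]_2) g : v != 0 ->
  ~ velocity (fun t : R => chart (u + t *: v)) 0 g 0.
Proof.
move=> v0 /velocity_cartan[_ _]; rewrite mulmx0 mul0mx mul0rn => dc.
have dg i j : is_derive 0 (1 : R) (fun t : R => gram (chart (u + t *: v)) i j) 0.
  apply: is_derive_eq (is_derive_coef n_gt0 P i j dc) _.
  by rewrite mxE mulmx0 mul0mx mxE.
have du i : is_derive 0 (1 : R) (fun t : R => (u + t *: v) 0 i) (v 0 i).
  rewrite (_ : (fun _ => _) = cst (u 0 i) + v 0 i \*: id); last first.
    by apply/funext => t; rewrite !mxE mulrC.
  apply: is_derive_eq (is_deriveD (is_derive_cst (u 0 i : R) (0 : R) (1 : R))
    (is_deriveZ (v 0 i) (is_derive_id (0 : R) (1 : R)))) _.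
  by rewrite add0r [_ *: _]mulr1.
have dE : is_derive 0 (1 : R) (fun t : R => expR (- (u + t *: v) 0 0))
    (expR (- u 0 0) * - v 0 0).
  have dN : is_derive 0 (1 : R) (fun t : R => - (u + t *: v) 0 0) (- v 0 0).
    exact: is_deriveN.
  by apply: is_derive_eq (is_derive_exp_comp dN) _; rewrite scale0r addr0.
have dEE := is_deriveM dE dE; have dEEx := is_deriveM dEE (du 1).
have da : is_derive 0 (1 : R) (fun t : R => horo_height (gram (chart (u + t *: v)))) 0.
  have d := is_deriveD (is_deriveB (is_deriveB (dg 0 0) (dg 0 1)) (dg 1 0)) (dg 1 1).
  apply: is_derive_eq (is_deriveM d (is_derive_cst (2^-1 : R) 0 (1 : R))) _.
  by rewrite !subr0 addr0 !scaler0 addr0.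
have db : is_derive 0 (1 : R) (fun t : R => horo_shift (gram (chart (u + t *: v)))) 0.
  have d := is_deriveB (dg 0 2) (dg 1 2).
  apply: is_derive_eq (is_deriveM d (is_derive_cst (2^-1 : R) 0 (1 : R))) _.
  by rewrite !subr0 !scaler0 addr0.
have E_neq0 : expR (- u 0 0) != 0 by rewrite gt_eqF // expR_gt0.
have v00 : v 0 0 = 0.
  rewrite (_ : (fun _ => _) = (fun t => expR (- (u + t *: v) 0 0)) *
      (fun t => expR (- (u + t *: v) 0 0))) in da; last first.
    by apply/funext => t; rewrite horo_height_chart expr2.
  have := @derive_val _ _ _ _ _ _ _ dEE; rewrite (@derive_val _ _ _ _ _ _ _ da).
  rewrite scale0r addr0 => /esym/eqP; rewrite -mulr2n mulrn_eq0 !scaler_eq0.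
  by rewrite oppr_eq0 /= (negPf E_neq0) => /eqP.
have v01 : v 0 1 = 0.
  rewrite (_ : (fun _ => _) = (fun t => expR (- (u + t *: v) 0 0)) *
      (fun t => expR (- (u + t *: v) 0 0)) * (fun t => (u + t *: v) 0 1)) in db; last first.
    by apply/funext => t; rewrite horo_shift_chart expr2.
  have := @derive_val _ _ _ _ _ _ _ dEEx; rewrite (@derive_val _ _ _ _ _ _ _ db).
  rewrite scale0r addr0 v00 oppr0 mulr0 scaler0 addr0 scaler0 addr0 => /esym/eqP.
  rewrite scaler_eq0 [X in X == 0](_ : _ = expR (- u 0 0) * expR (- u 0 0)).
    by rewrite mulf_eq0 (negPf E_neq0) => /eqP.
  by rewrite -[in RHS](addr0 u) -(scale0r v).
by move/eqP: v0; apply; apply: rV2P; rewrite ?v00 ?v01 mxE.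
Qed.

Lemma lorentz_orbit_submanifold : submanifold 2 (lorentz_orbit P).
Proof.
move=> p Sp; exists setT, setT, chart; split.
- by split; [exact: openT|].
- by split; [exact: openT|exact: chart_smooth].
- split; first by rewrite setIT range_chart.
  by move=> x y _ _ /(congr1 chart_inv); rewrite !chartK.
- by move=> u v g _ v0; apply: chart_immersion; apply/eqP.
- by move=> U' oU' _; exact: chart_open.
Qed.

End Surface.

(** * Orthonormalization and the tangent plane *)

Section Orthonormalization.
Context {R : realType} {n m : nat}.
Hypothesis n_gt0 : (0 < n)%N.
Local Notation C := R[i].
Implicit Types X Y Z : 'M[C]_(m, n).

Lemma adjZ (a : R) X : (a%:C *: X)^t* = a%:C *: X^t*.
Proof.
by apply/matrixP => i j; rewrite !mxE rmorphM; congr (_ * _); exact: conjc_real.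
Qed.

Lemma homothety_real X (c : C) : X^t* *m X = c%:M ->
  exists2 l : R, 0 <= l & c = l%:C.
Proof.
move=> XX; have c_ge0 : 0 <= c.
  have -> : c = (X^t* *m X) (Ordinal n_gt0) (Ordinal n_gt0).
    by rewrite XX mxE eqxx mulr1n.
  by rewrite mxE sumr_ge0 // => k _; rewrite !mxE mulrC mul_conjC_ge0.
have cE : c = (complex.Re c)%:C by rewrite RRe_real // ger0_real.
by exists (complex.Re c); rewrite -?lecR -cE.
Qed.

Lemma homothety0 X : X^t* *m X = 0 -> X = 0.
Proof.
move=> XX; apply/matrixP => k j; rewrite [RHS]mxE.
have /eqP := congr1 (fun M : 'M[C]_n => M j j) XX.
rewrite !mxE psumr_eq0 => [/allP/(_ k (mem_index_enum k))|i _].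
  by rewrite !mxE mulrC mul_conjC_eq0 => /eqP.
by rewrite !mxE mulrC mul_conjC_ge0.
Qed.

Lemma homothety_normalize X (l : R) : X^t* *m X = (l%:C)%:M -> X != 0 ->
  exists2 a : R, a != 0 & (a%:C *: X)^t* *m (a%:C *: X) = 1%:M.
Proof.
move=> XX X0; have l_gt0 : 0 < l.
  have [l' l'_ge0 [ll']] := homothety_real XX; rewrite lt_neqAle ll' l'_ge0 andbT.
  by apply: contra_neq X0 => l0; apply: homothety0; rewrite XX ll' -l0 raddf0.
exists (Num.sqrt l)^-1; first by rewrite invr_eq0 gt_eqF // sqrtr_gt0.
rewrite adjZ -scalemxAl -scalemxAr XX scalerA scale_scalar_mx -!rmorphM /=.
rewrite -expr2 exprVn sqr_sqrtr ?ltW// mulVf ?gt_eqF//.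
Qed.

(** The Gram-Schmidt process in matrix form.  It works because X^* X, Y^* Y and X^* Y
    are all real scalar matrices: then so is Z^* Z for Z = Y - t X. *)
Lemma orthonormal_pair X Y (l mu : R) :
  X^t* *m X = (l%:C)%:M -> Umn Y -> X^t* *m Y = (mu%:C)%:M -> X != 0 ->
  (forall t : R, Y <> t%:C *: X) ->
  exists a b t : R, [/\ a != 0, b != 0 &
    let P i := if i == 0 :> 'I_2 then a%:C *: X else b%:C *: (Y - t%:C *: X) in
    forall i j, (P i)^t* *m P j = (i == j)%:R%:M].
Proof.
move=> XX [nu _ YY] XY X0 nXY.
have [a a0 aX] := homothety_normalize XX X0.
have l0 : l != 0.
  by apply: contra_neq X0 => l0; apply: homothety0; rewrite XX l0 raddf0.
have [nu' _ nuE] := homothety_real YY; rewrite {nu}nuE in YY.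
pose t := mu / l; pose Z := Y - t%:C *: X.
have XZ : X^t* *m Z = 0.
  rewrite mulmxBr -scalemxAr XX XY scale_scalar_mx -rmorphM /= divfK // subrr //.
have ZX : Z^t* *m X = 0 by rewrite -[LHS]trmxCK adjM trmxCK XZ trmx0 map_mx0.
have ZZ : Z^t* *m Z = ((nu' - t * mu)%:C)%:M.
  rewrite {2}/Z mulmxBr -scalemxAr ZX scaler0 subr0 /Z.
  rewrite raddfB /= map_mxB adjZ mulmxBl -scalemxAl YY XY scale_scalar_mx.
  by rewrite -raddfB /= -rmorphM -rmorphB.
have Z0 : Z != 0 by rewrite subr_eq0; apply/eqP; exact: nXY.
have [b b0 bZ] := homothety_normalize ZZ Z0.
exists a, b, t; split=> // P i j; rewrite /P -/Z.
have ord2 (k : 'I_2) : k != 0 -> k = 1.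
  by case: k => [[|[|//]]] // k2 _; exact: val_inj.
have [->|/ord2 ->] := eqVneq i 0.
  by have [_|_] := eqVneq j 0 => //; rewrite adjZ -scalemxAl -scalemxAr XZ !scaler0 raddf0.
by have [->|/ord2 ->] := eqVneq j 0 => //; rewrite adjZ -scalemxAl -scalemxAr ZX !scaler0 raddf0.
Qed.

End Orthonormalization.

Section Dimension.
Context {R : realType} {p q : nat}.
Implicit Types A : 'M[R[i]]_(p, q).

Lemma rspan2 A B : rspan [:: A; B] =
  [set M | exists a b : R, M = a%:C *: A + b%:C *: B].
Proof.
apply/seteqP; split=> [_ [c ->]|_ [a [b ->]]].
  exists (c 0), (c 1); rewrite !big_ord_recl big_ord0 addr0 /=.
  by congr (_ + (c _)%:C *: _); apply: val_inj.
exists (fun i => if i == 0 :> 'I_2 then a else b).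
by rewrite !big_ord_recl big_ord0 addr0.
Qed.

Lemma rdim_collinear A (t : R) : ~ rdim (rspan [:: A; t%:C *: A]) 2.
Proof.
move=> [s [sz free sE]].
case: s sz free sE => [|B [|D [|]]] // _ free /seteqP[_ sE].
have span M : rspan [:: B; D] M -> exists c : R, M = c%:C *: A.
  move=> /sE; rewrite rspan2 => -[a [b ->]]; exists (a + b * t).
  by rewrite scalerA -scalerDl -rmorphM -rmorphD.
have [b BE] : exists b : R, B = b%:C *: A.
  apply: span; rewrite rspan2; exists 1, 0.
  by rewrite rmorph1 rmorph0 scale1r scale0r addr0.
have [d DE] : exists d : R, D = d%:C *: A.
  apply: span; rewrite rspan2; exists 0, 1.
  by rewrite rmorph1 rmorph0 scale1r scale0r add0r.
have bd0 := free (fun i => if i == 0 then d else - b).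
rewrite !big_ord_recl big_ord0 /= addr0 BE DE !scalerA -scalerDl -!rmorphM -rmorphD /= in bd0.
rewrite mulNr [d * b]mulrC subrr scale0r in bd0.
(* Both B and D are multiples of A, hence d B - b D = 0. *)
have b0 : b = 0 by apply: oppr_inj; rewrite oppr0; exact: (bd0 erefl 1).
have := free (fun i => if i == 0 then 1 else 0).
rewrite !big_ord_recl big_ord0 /= addr0 BE b0 !scale0r scaler0 addr0 => /(_ erefl 0)/eqP.
by rewrite oner_eq0.
Qed.

End Dimension.

Section Main.
Context {R : realType} {n m : nat}.
Local Notation C := R[i].

Lemma translate1 (S : set (Dnm R n m)) : translate (G1 R n m) S = S.
Proof.
have e g : gmul (G1 R n m) g = g by apply: gmx_inj; exact: mul1mx.
apply/seteqP; split=> [_ [h Sh ->]|p Sp]; first by rewrite e.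
by exists (repr p); rewrite ?e coset_repr.
Qed.

Lemma lorentz_orbit_complete_tg (P : 'I_2 -> 'M[C]_(m, n)) : (0 < n)%N ->
  (forall i j, (P i)^t* *m P j = (i == j)%:R%:M) ->
  complete_tg_submanifold 2 (lorentz_orbit P).
Proof.
move=> n_gt0 orthoP; split.
- exact: lorentz_orbit_submanifold.
- exact: lorentz_orbit_connected.
- exact: lorentz_orbit_totally_geodesic.
- exact: lorentz_orbit_complete.
Qed.

Lemma rspan_orthonormal (X Y : 'M[C]_(m, n)) (a b t : R) : a != 0 -> b != 0 ->
  rspan [:: hat X; hat Y] =
  rspan [:: hat (a%:C *: X); hat (b%:C *: (Y - t%:C *: X))].
Proof.
move=> a0 b0; rewrite !rspan2.
have hatB (Z W : 'M[C]_(m, n)) (r : R) : hat (Z - r%:C *: W) = hat Z - r%:C *: hat W.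
  by rewrite -scaleNr -rmorphN hatD hatZ rmorphN scaleNr.
rewrite !hatZ hatB; apply/seteqP; split=> _ [x [y ->]].
- exists ((x + y * t) / a), (y / b); rewrite !scalerA -!rmorphM !divfK //.
  by rewrite rmorphD rmorphM scalerDl scalerBr scalerA addrACA subrr addr0.
- exists (x * a - y * b * t), (y * b); rewrite !scalerA -!rmorphM scalerBr scalerA -rmorphM.
  by rewrite rmorphB scalerBl addrA [RHS]addrAC.
Qed.

Lemma tangent_lorentz_orbit2 (P : 'I_2 -> 'M[C]_(m, n)) : (0 < n)%N ->
  (forall i j, (P i)^t* *m P j = (i == j)%:R%:M) ->
  tangent (lorentz_orbit P) (G1 R n m) = rspan [:: hat (P 0); hat (P 1)].
Proof.
move=> n_gt0 orthoP; rewrite tangent_lorentz_orbit // rspan2.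
have P1 : P (lift ord0 ord0) = P 1 by congr P; exact: val_inj.
apply/seteqP; split=> [_ [T bT ->]|_ [a [b ->]]].
  exists (T ord0 (lift ord0 ord0)), (T ord0 (lift ord0 (lift ord0 ord0))).
  by rewrite (frame_mx_hat P bT) !big_ord_recl big_ord0 addr0 hatD !hatZ P1.
pose c i := if i == 0 :> 'I_2 then a else b.
exists (boost_gen_of c); first exact: boost_gen_ofP.
by rewrite frame_mx_boost_gen_of !big_ord_recl big_ord0 addr0 hatD !hatZ P1.
Qed.

End Main.

Theorem corollary3p6 (R : realType) (n m : nat) (X Y : 'M[R[i]]_(m, n))
  (hX : Umn X) (hY : Umn Y)
  (hdim : rdim (rspan [:: hat X; hat Y]) 2)
  (hXY : exists mu : R, X^t* *m Y = (mu%:C)%:M) :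
  exists S : set (Dnm R n m),
    complete_tg_submanifold 2 S /\ gives_rise_to 2 (rspan [:: hat X; hat Y]) S.
Proof.
have nXY (t : R) : Y <> t%:C *: X.
  by move=> YE; apply: (@rdim_collinear _ _ _ (hat X) t); rewrite -hatZ -YE.
(* For n = 0 all matrices with n columns are equal. *)
have n_gt0 : (0 < n)%N.
  rewrite lt0n; apply/eqP => n0; apply: (nXY 0); apply/matrixP => i j.
  by have := ltn_ord j; rewrite {2}n0.
have [l l0 XX] := hX; have [lr _ lE] := homothety_real n_gt0 XX.
have [mu XY] := hXY.
have X0 : X != 0.
  apply: contra_neq l0 => X0; move: XX; rewrite X0 mulmx0.
  move=> /matrixP/(_ (Ordinal n_gt0) (Ordinal n_gt0)).
  by rewrite !mxE eqxx mulr1n.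
rewrite lE in XX.
have [a [b [t [a0 b0 orthoP]]]] := orthonormal_pair n_gt0 XX hY XY X0 nXY.
set P := (fun i => _) in orthoP.
exists (lorentz_orbit P); split; first exact: lorentz_orbit_complete_tg.
exists (lorentz_orbit P), (G1 R n m); split.
- exact: lorentz_orbit_complete_tg.
- exists (G1 R n m) => //; exists 1%:M; first exact: lorentz1.
  by rewrite frame_rep1.
- by rewrite tangent_lorentz_orbit2 // (rspan_orthonormal X Y t a0 b0).
- by rewrite translate1.
Qed.
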